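(* For every integer $n\geq 1$, the following identity holds in $\Delta_q$, where $B_{n\delta}$ denotes the image in $\Delta_q$, under the algebra homomorphism $\natural:\mathcal O_q\to\Delta_q$, of the element $B_{n\delta}$ of $\mathcal O_q$: \begin{align*} B_{n\delta} = (-1)^n\big(1-q^{-2}\big)\Bigg\{ & \Omega \sum_{\ell \in \mathbb N}[n-2\ell-1]_q\, U_{n-2\ell-2}(C) +\alpha\beta \sum_{\ell \in \mathbb N}\ell^2 [n-2\ell]_q\,U_{n-2\ell-1}(C)\\ & -(\alpha^2+\beta^2)\sum_{\ell \in \mathbb N}\binom{\ell+1}{2} [n-2\ell-1]_q\, U_{n-2\ell-2}(C)\\ & +\gamma\Big([n]_q\, U_{n-1}(C)+2\sum_{\ell\in \mathbb N} [n-2\ell-2]_q\, U_{n-2\ell-3}(C)\Big)\\ & -[n+1]_q\, U_n(C)-[3]_q [n-1]_q\, U_{n-2}(C)- [2]_q^2\sum_{\ell \in \mathbb N } [n-2\ell-3]_q\, U_{n-2\ell-4}(C)\Bigg\}. \end{align*}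
   Context: $\mathbb N=\{0,1,2,\ldots\}$. $\mathbb F$ is an algebraically closed field of characteristic zero; $q\in\mathbb F$ is nonzero and not a root of $1$. Algebras are associative unital $\mathbb F$-algebras. For $n\in\mathbb Z$, $[n]_q=\frac{q^n-q^{-n}}{q-q^{-1}}$. The $q$-Onsager algebra $\mathcal O_q$ is the algebra with generators $A,B$ and relations $A^3B-[3]_qA^2BA+[3]_qABA^2-BA^3=(q^2-q^{-2})^2(BA-AB)$ and $B^3A-[3]_qB^2AB+[3]_qBAB^2-AB^3=(q^2-q^{-2})^2(AB-BA)$. It is known (Baseilhac and Kolb) that $\mathcal O_q$ has algebra automorphisms $T_0,T_1$ determined by $T_0(A)=A$, $T_0(B)=B+\frac{qA^2B-(q+q^{-1})ABA+q^{-1}BA^2}{(q-q^{-1})(q^2-q^{-2})}$, $T_1(B)=B$, $T_1(A)=A+\frac{qB^2A-(q+q^{-1})BAB+q^{-1}AB^2}{(q-q^{-1})(q^2-q^{-2})}$, whose inverses satisfy $T_0^{-1}(A)=A$, $T_0^{-1}(B)=B+\frac{q^{-1}A^2B-(q+q^{-1})ABA+qBA^2}{(q-q^{-1})(q^2-q^{-2})}$, $T_1^{-1}(B)=B$, $T_1^{-1}(A)=A+\frac{q^{-1}B^2A-(q+q^{-1})BAB+qAB^2}{(q-q^{-1})(q^2-q^{-2})}$. Elements of $\mathcal O_q$: for $r\geq 0$, $B_{2r\delta+\alpha_1}=(T_1^{-1}T_0^{-1})^r(B)$, $B_{(2r+1)\delta+\alpha_1}=(T_1^{-1}T_0^{-1})^rT_1^{-1}(A)$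 (so $B_{0\delta+\alpha_1}=B$), and for $n\geq1$, $$B_{n\delta}=q^{-2}B_{(n-1)\delta+\alpha_1}A-AB_{(n-1)\delta+\alpha_1}+(q^{-2}-1)\sum_{\ell=0}^{n-2}B_{\ell\delta+\alpha_1}B_{(n-\ell-2)\delta+\alpha_1}.$$ The universal Askey--Wilson algebra $\Delta_q$ is the algebra with generators $A,B,C$ and relations asserting that each of $A+\frac{qBC-q^{-1}CB}{q^2-q^{-2}}$, $B+\frac{qCA-q^{-1}AC}{q^2-q^{-2}}$, $C+\frac{qAB-q^{-1}BA}{q^2-q^{-2}}$ is central. The central elements $\alpha,\beta,\gamma$ of $\Delta_q$ are these three elements, respectively, each multiplied by $q+q^{-1}$. The Casimir element is $$\Omega=qABC+q^2A^2+q^{-2}B^2+q^2C^2-qA\alpha-q^{-1}B\beta-qC\gamma,$$ which is known to be central in $\Delta_q$. It is known that there is an algebra homomorphism $\natural:\mathcal O_q\to\Delta_q$ sending $A\mapsto A$, $B\mapsto B$. For the elements $B_{n\delta+\alpha_1}$ ($n\geq 0$) and $B_{n\delta}$ ($n\geq 1$) of $\mathcal O_q$, the same notation is used for their images under $\natural$. Chebyshev polynomials of the second kind (monic normalization): $U_n\in\mathbb F[x]$ with $U_0=1$, $U_1=x$, $xU_n=U_{n+1}+U_{n-1}$ for $n\geq1$, and $U_n=0$ for all integers $n<0$ (so all the sums over $\mathbb N$ are finite). *)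

(* Defs.v *)
From HB Require Import structures.
From mathcomp Require Import all_boot all_order all_algebra.
From mathcomp Require Import ring_quotient generic_quotient.
From mathcomp Require Import ring boolp.
From mathcomp Require Import monalg.

Set Implicit Arguments.
Unset Strict Implicit.
Unset Printing Implicit Defensive.

Import GRing.Theory.
Local Open Scope ring_scope.
Local Open Scope quotient_scope.

Notation free_alg F X := {malg F[{fmonom X}]}.

Definition free_gen (F : fieldType) (X : choiceType) (x : X) : free_alg F X :=
  << fmu x >>.

Lemma free_scalerAr (F : fieldType) (X : choiceType) (c : F)
    (u v : free_alg F X) : c *: (u * v) = u * (c *: v).
Proof.
have cstC (w : free_alg F X) : w * c%:MP = c *: w.
  rewrite -mul_malgC !malgM_def fgmulgU fgmulUg.
  by apply: eq_bigr => k _; rewrite mulrC mulm1 mul1m.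
by rewrite -(cstC v) mulrA cstC.
Qed.

Inductive ideal_gen (A : nzRingType) (S : A -> Prop) : A -> Prop :=
| Ideal_gen r : S r -> ideal_gen S r
| Ideal_0 : ideal_gen S 0
| Ideal_add u v : ideal_gen S u -> ideal_gen S v -> ideal_gen S (u + v)
| Ideal_mull a u : ideal_gen S u -> ideal_gen S (a * u)
| Ideal_mulr u a : ideal_gen S u -> ideal_gen S (u * a).

Definition ideal_pred (A : nzRingType) (S : A -> Prop) : {pred A} :=
  fun u => `[< ideal_gen S u >].

Section IdealPred.
Context (A : nzRingType) (S : A -> Prop).

Lemma ideal_predP u : reflect (ideal_gen S u) (u \in ideal_pred S).
Proof. exact: asboolP. Qed.

Lemma ideal_zmod_closed : zmod_closed (ideal_pred S).
Proof.
split=> [|u v /ideal_predP Su /ideal_predP Sv]; apply/ideal_predP.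
  exact: Ideal_0.
by apply: Ideal_add => //; rewrite -mulN1r; apply: Ideal_mull.
Qed.

HB.instance Definition _ :=
  GRing.isZmodClosed.Build A (ideal_pred S) ideal_zmod_closed.
End IdealPred.

(* [presented S0] is the associative unital F-algebra with generators X and    *)
(* relations r = 0 for r in S, that is, the free algebra modulo the two-sided  *)
(* ideal generated by S. MathComp algebras are nontrivial, hence the argument  *)
(* S0 : the elements of S have no constant term.                               *)
Section Presented.
Context (F : fieldType) (X : choiceType) (S : free_alg F X -> Prop).
Context (S0 : forall r, S r -> r@_(fmone X) = 0).

Definition presented of (forall r, S r -> r@_(fmone X) = 0) : Type :=
  Quotient.quot (ideal_pred S).

Local Notation Q := (presented S0).

HB.instance Definition _ := GRing.Zmodule.on Q.
HB.instance Definition _ :=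
  EqQuotient.copy Q (Quotient.quot (ideal_pred S)).

Definition presented_pi (u : free_alg F X) : Q := locked (\pi_Q u).
Local Notation pi := presented_pi.

Lemma presented_piP u v : pi u = pi v <-> ideal_gen S (u - v).
Proof.
rewrite /pi -!lock; split=> [/eqP|] h.
  by apply/ideal_predP; rewrite Quotient.idealrBE.
by apply/eqP; move/ideal_predP: h; rewrite Quotient.idealrBE.
Qed.

Lemma presented_pi_surj (a : Q) : exists u, a = pi u.
Proof. by exists (repr a); rewrite /pi -lock reprK. Qed.

Lemma presented_piB : {morph pi : u v / u - v}.
Proof.
by move=> u v; rewrite /pi -!lock (raddfB \pi_(Quotient.quot (ideal_pred S))).
Qed.

Lemma presented_piD : {morph pi : u v / u + v}.
Proof.
by move=> u v; rewrite /pi -!lock (raddfD \pi_(Quotient.quot (ideal_pred S))).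
Qed.

Definition presented_one : Q := pi 1.
Definition presented_mul (a b : Q) : Q := locked (pi (repr a * repr b)).
Definition presented_scale (c : F) (a : Q) : Q := locked (pi (c *: repr a)).

Let repr_pi u : ideal_gen S (repr (pi u) - u).
Proof. by apply/presented_piP; rewrite /pi -!lock reprK. Qed.

Lemma presented_piM u v : pi (u * v) = presented_mul (pi u) (pi v).
Proof.
rewrite /presented_mul -lock; apply/esym/presented_piP; set u' := repr _; set v' := repr _.
have -> : u' * v' - u * v = (u' - u) * v' + u * (v' - v).
  by rewrite mulrBl mulrBr addrA subrK.
by apply: Ideal_add; [apply: Ideal_mulr | apply: Ideal_mull]; apply: repr_pi.
Qed.

Lemma presented_piZ c u : pi (c *: u) = presented_scale c (pi u).
Proof.
rewrite /presented_scale -lock; apply/esym/presented_piP; rewrite -scalerBr -[_ - _]mul1r scalerAl.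
exact/Ideal_mull/repr_pi.
Qed.

Local Ltac lift_reprs :=
  repeat match goal with a : _ |- _ =>
    let u := fresh "u" in case: (presented_pi_surj a) => u ->; clear a end.

Let mulA : associative presented_mul.
Proof. by move=> a b c; lift_reprs; rewrite -!presented_piM mulrA. Qed.

Let mul1 : left_id presented_one presented_mul.
Proof. by move=> a; lift_reprs; rewrite -!presented_piM mul1r. Qed.

Let mul_1 : right_id presented_one presented_mul.
Proof. by move=> a; lift_reprs; rewrite -!presented_piM mulr1. Qed.

Let mulDl : left_distributive presented_mul +%R.
Proof.
move=> a b c; lift_reprs.
by rewrite -presented_piD -!presented_piM -presented_piD mulrDl.
Qed.

Let mulDr : right_distributive presented_mul +%R.
Proof.
move=> a b c; lift_reprs.
by rewrite -presented_piD -!presented_piM -presented_piD mulrDr.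
Qed.

Let ideal_cst0 r : ideal_gen S r -> r@_(fmone X) = 0.
Proof.
elim=> {r} [r /S0 //||u v _ hu _ hv|a u _ hu|u a _ hu].
- exact: mcoeff0.
- by rewrite mcoeffD hu hv addr0.
- by rewrite (mcoeff1g_is_multiplicative _ _).1 hu mulr0.
- by rewrite (mcoeff1g_is_multiplicative _ _).1 hu mul0r.
Qed.

Let one_neq0 : presented_one != 0.
Proof.
apply/eqP => h; have := @presented_piB 1 1; rewrite !subrr -h => /esym.
move=> /presented_piP /ideal_cst0; rewrite subr0 mcoeff1 eqxx.
by move/eqP; rewrite oner_eq0.
Qed.

HB.instance Definition _ := GRing.Zmodule_isNzRing.Build Q
  mulA mul1 mul_1 mulDl mulDr one_neq0.

Let scaleA c d a :
  presented_scale c (presented_scale d a) = presented_scale (c * d) a.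
Proof. by lift_reprs; rewrite -!presented_piZ scalerA. Qed.

Let scale1 : left_id 1 presented_scale.
Proof. by move=> a; lift_reprs; rewrite -!presented_piZ scale1r. Qed.

Let scaleDr : right_distributive presented_scale +%R.
Proof.
move=> c a b; lift_reprs.
by rewrite -presented_piD -!presented_piZ -presented_piD scalerDr.
Qed.

Let scaleDl a : {morph presented_scale^~ a : c d / c + d}.
Proof.
by move=> c d; lift_reprs; rewrite -!presented_piZ -presented_piD scalerDl.
Qed.

HB.instance Definition _ := GRing.Zmodule_isLmodule.Build F Q
  scaleA scale1 scaleDr scaleDl.

Let scaleAl (c : F) (a b : Q) : c *: (a * b) = c *: a * b.
Proof.
lift_reprs; change (presented_scale c (presented_mul (pi u0) (pi u)) =
  presented_mul (presented_scale c (pi u0)) (pi u)).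
by rewrite -!(presented_piM, presented_piZ) scalerAl.
Qed.

HB.instance Definition _ := GRing.Lmodule_isLalgebra.Build F Q scaleAl.

Let scaleAr (c : F) (a b : Q) : c *: (a * b) = a * (c *: b).
Proof.
lift_reprs; change (presented_scale c (presented_mul (pi u0) (pi u)) =
  presented_mul (pi u0) (presented_scale c (pi u))).
by rewrite -!(presented_piM, presented_piZ) free_scalerAr.
Qed.

HB.instance Definition _ := GRing.Lalgebra_isAlgebra.Build F Q scaleAr.

HB.instance Definition _ := GRing.isZmodMorphism.Build (free_alg F X) Q
  presented_pi presented_piB.
HB.instance Definition _ := GRing.isMonoidMorphism.Build (free_alg F X) Q
  presented_pi (erefl, presented_piM).
HB.instance Definition _ := GRing.isScalable.Build F (free_alg F X) Q *:%R
  presented_pi presented_piZ.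

Lemma presented_rel r : S r -> pi r = 0.
Proof.
by move=> Sr; rewrite -(raddf0 pi); apply/presented_piP; rewrite subr0; apply: Ideal_gen.
Qed.

Lemma presented_comm t u : S (t * u - u * t) -> pi t * pi u = pi u * pi t.
Proof.
move=> h; have e := (presented_piP (t * u) (u * t)).2 (Ideal_gen h).
exact: etrans (esym (presented_piM t u)) (etrans e (presented_piM u t)).
Qed.

Definition presented_gen (x : X) : Q := pi (free_gen F x).
End Presented.

Section Lift.
Context (F : fieldType) (X : choiceType) (B : algType F) (f : X -> B).

Definition free_monom (m : fmonom X) : B := \prod_(x <- m : seq X) f x.

Lemma free_monom_mmorphism : mmorphism free_monom.
Proof.
split=> [m1 m2|]; rewrite /free_monom; last by rewrite fm1 big_nil.
by rewrite fmM big_cat.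
Qed.

HB.instance Definition _ :=
  isMultiplicative.Build (fmonom X) B free_monom free_monom_mmorphism.

Definition free_lift : free_alg F X -> B := mmap (in_alg B) free_monom.

Lemma free_lift_zmod_morphism : zmod_morphism free_lift.
Proof. exact: raddfB. Qed.

Lemma free_lift_monoid_morphism : monoid_morphism free_lift.
Proof.
have [|h1 h2] := @commr_mmap_is_multiplicative (fmonom X) F B (in_alg B) free_monom.
  by move=> g m m'; rewrite /GRing.comm /= mulr_algl mulr_algr.
by split.
Qed.

Lemma free_lift_scalable : scalable free_lift.
Proof. by move=> c u; rewrite /free_lift mmapZ /= mulr_algl. Qed.

HB.instance Definition _ := GRing.isZmodMorphism.Build (free_alg F X) B
  free_lift free_lift_zmod_morphism.
HB.instance Definition _ := GRing.isMonoidMorphism.Build (free_alg F X) B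
  free_lift free_lift_monoid_morphism.
HB.instance Definition _ := GRing.isScalable.Build F (free_alg F X) B *:%R
  free_lift free_lift_scalable.

Lemma free_lift_gen x : free_lift (free_gen F x) = f x.
Proof.
rewrite /free_lift mmapU /= scale1r mul1r.
by rewrite /free_monom fmU big_seq1.
Qed.

Context (S : free_alg F X -> Prop) (S0 : forall r, S r -> r@_(fmone X) = 0).

Definition presented_lift of (forall r, S r -> free_lift r = 0) :
  presented S0 -> B := fun a => free_lift (repr a).

Context (fS : forall r, S r -> free_lift r = 0).
Local Notation lift := (presented_lift fS).

Lemma presented_lift_pi u : lift (presented_pi S0 u) = free_lift u.
Proof.
suff ideal0 r : ideal_gen S r -> free_lift r = 0.
  apply/eqP; rewrite -subr_eq0 -raddfB; apply/eqP/ideal0/presented_piP.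
  by rewrite /presented_pi -lock reprK.
elim=> {r} [r /fS //||v w _ hv _ hw|a v _ hv|v a _ hv].
- exact: raddf0.
- by rewrite raddfD /= hv hw addr0.
- by rewrite rmorphM /= hv mulr0.
- by rewrite rmorphM /= hv mul0r.
Qed.

Lemma presented_lift_zmod_morphism : zmod_morphism lift.
Proof.
move=> a b; have [u ->] := presented_pi_surj a.
have [v ->] := presented_pi_surj b.
by rewrite -presented_piB !presented_lift_pi raddfB.
Qed.

Lemma presented_lift_monoid_morphism : monoid_morphism lift.
Proof.
split=> [|a b]; first by rewrite presented_lift_pi rmorph1.
have [u ->] := presented_pi_surj a; have [v ->] := presented_pi_surj b.
by rewrite -[_ * _]presented_piM !presented_lift_pi rmorphM.
Qed.

Lemma presented_lift_scalable : scalable lift.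
Proof.
move=> c a; have [u ->] := presented_pi_surj a.
by rewrite -[_ *: _]presented_piZ !presented_lift_pi linearZ.
Qed.

HB.instance Definition _ := GRing.isZmodMorphism.Build (presented S0) B
  lift presented_lift_zmod_morphism.
HB.instance Definition _ := GRing.isMonoidMorphism.Build (presented S0) B
  lift presented_lift_monoid_morphism.
HB.instance Definition _ := GRing.isScalable.Build F (presented S0) B *:%R
  lift presented_lift_scalable.

Lemma presented_lift_gen x : lift (presented_gen S0 x) = f x.
Proof. by rewrite presented_lift_pi free_lift_gen. Qed.

End Lift.

Lemma presented_hom_ext (F : fieldType) (X : choiceType)
    (S : free_alg F X -> Prop) (S0 : forall r, S r -> r@_(fmone X) = 0)
    (B : algType F) (g h : {lrmorphism presented S0 -> B}) :
  (forall x, g (presented_gen S0 x) = h (presented_gen S0 x)) -> g =1 h.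
Proof.
move=> gh a; have [u ->] := presented_pi_surj a.
have piM v w : presented_pi S0 (v * w) = presented_pi S0 v * presented_pi S0 w.
  exact: presented_piM.
have pi_sum (I : Type) (r : seq I) (G : I -> free_alg F X) :
    presented_pi S0 (\sum_(i <- r) G i) = \sum_(i <- r) presented_pi S0 (G i).
  elim: r => [|i r IH]; last by rewrite !big_cons presented_piD IH.
  by rewrite !big_nil -[0 in LHS](subrr 0) presented_piB subrr.
rewrite (monalgE u) pi_sum !raddf_sum; apply: eq_bigr => m _ /=.
have -> : << u@_m *g m >> = u@_m *: << m >> :> free_alg F X.
  by rewrite -mul_malgC malgM_def fgmulUU mulr1 mul1m.
rewrite [presented_pi _ _]presented_piZ -/(_ *: _).
rewrite -[presented_scale _ _]/(u@_m *: presented_pi S0 _) !linearZ /=.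
congr (_ *: _); case: m => s; elim: s => [|x s IH].
  by rewrite -fmoneE -[presented_pi _ _]/(1 : presented S0) !rmorph1.
have -> : << FMonom (x :: s) >> = free_gen F x * << FMonom s >>.
  by rewrite malgM_def fgmulUU mulr1 /mmul /= fmmulE fmuE.
by rewrite piM !rmorphM /= IH; congr (_ * _); apply: gh.
Qed.

Section QFormulas.
Context (F : fieldType) (q : F).

Definition qint (n : int) : F := (q ^ n - q ^ (- n)) / (q - q^-1).

Fixpoint chebyU_nat (n : nat) : {poly F} :=
  match n with
  | 0 => 1
  | 1 => 'X
  | (m.+1 as k).+1 => 'X * chebyU_nat k - chebyU_nat m
  end.

(* As chebyU vanishes at negative integers, for j >= 1 the sum over all l in N *)
(* of multiples of chebyU (n - 2l - j) only has nonzero terms for l < n.       *)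
Definition chebyU (n : int) : {poly F} :=
  match n with Posz m => chebyU_nat m | Negz _ => 0 end.

Definition onsager_rel (A : lalgType F) (a b : A) : A :=
  a ^+ 3 * b - qint 3 *: (a ^+ 2 * b * a) + qint 3 *: (a * b * a ^+ 2)
  - b * a ^+ 3 - (q ^+ 2 - q ^- 2) ^+ 2 *: (b * a - a * b).

(* [lusztig q A B] is T_0(B); exchanging A and B gives T_1(A). *)
Definition lusztig (A : lalgType F) (a b : A) : A :=
  b + ((q - q^-1) * (q ^+ 2 - q ^- 2))^-1 *:
    (q *: (a ^+ 2 * b) - (q + q^-1) *: (a * b * a) + q^-1 *: (b * a ^+ 2)).

(* The element A + (q BC - q^-1 CB) / (q^2 - q^-2); the other two central *)
(* elements are obtained by cyclic rotation of (A, B, C).                 *)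
Definition aw_elt (A : lalgType F) (a b c : A) : A :=
  a + (q ^+ 2 - q ^- 2)^-1 *: (q *: (b * c) - q^-1 *: (c * b)).

Lemma onsager_rel_hom (A B : lalgType F) (f : {lrmorphism A -> B}) (a b : A) :
  f (onsager_rel a b) = onsager_rel (f a) (f b).
Proof.
have fD u v : f (u + v) = f u + f v by exact: raddfD.
have fN u : f (- u) = - f u by exact: raddfN.
have fZ (c : F) u : f (c *: u) = c *: f u by exact: linearZ.
by rewrite /onsager_rel !(fD, fN, fZ, rmorphM, rmorphXn).
Qed.

Lemma aw_elt_hom (A B : lalgType F) (f : {lrmorphism A -> B}) (a b c : A) :
  f (aw_elt a b c) = aw_elt (f a) (f b) (f c).
Proof.
have fD u v : f (u + v) = f u + f v by exact: raddfD.
have fN u : f (- u) = - f u by exact: raddfN.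
have fZ (d : F) u : f (d *: u) = d *: f u by exact: linearZ.
by rewrite /aw_elt !(fD, fN, fZ, rmorphM).
Qed.

End QFormulas.

Section Onsager.
Context (F : fieldType) (q : F).

Local Notation a := (free_gen F (0 : 'I_2)).
Local Notation b := (free_gen F (1 : 'I_2)).

Variant Oq_rel : free_alg F 'I_2 -> Prop :=
| Oq_rel_AB : Oq_rel (onsager_rel q a b)
| Oq_rel_BA : Oq_rel (onsager_rel q b a).

Lemma onsager_rel_comm (A : lalgType F) (f : A -> F) (x y : A) :
    zmod_morphism f -> {morph f : u v / u * v} -> scalable_for *%R f ->
  f (onsager_rel q x y) = 0.
Proof.
move=> fB fM fZ; rewrite /onsager_rel.
move: (qint q 3) ((q ^+ 2 - q ^- 2) ^+ 2) => k e.
have f0 : f 0 = 0 by rewrite -[0 in LHS](subrr 0) fB subrr.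
have fN u : f (- u) = - f u by rewrite -sub0r fB f0 sub0r.
have fD u v : f (u + v) = f u + f v by rewrite -[v in LHS]opprK fB fN opprK.
by rewrite !(fD, fN, fZ, fM, exprS, expr0, mulr1); ring.
Qed.

Lemma Oq_rel_cst0 r : Oq_rel r -> r@_(fmone 'I_2) = 0.
Proof.
have fM := (@mcoeff1g_is_multiplicative (fmonom 'I_2) F).1.
have fB : zmod_morphism (@mcoeff (fmonom 'I_2) F (fmone 'I_2)).
  by move=> u v; apply: mcoeffB.
have fZ : scalable_for *%R (@mcoeff (fmonom 'I_2) F (fmone 'I_2)).
  by move=> c u; apply: mcoeffZ.
by case; apply: onsager_rel_comm fB fM fZ.
Qed.

Definition Oq := presented Oq_rel_cst0.
HB.instance Definition _ := GRing.Algebra.on Oq.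

Definition OqA : Oq := presented_gen Oq_rel_cst0 0.
Definition OqB : Oq := presented_gen Oq_rel_cst0 1.

Lemma Oq_AB : onsager_rel q OqA OqB = 0.
Proof.
rewrite -(onsager_rel_hom q (presented_pi Oq_rel_cst0)).
exact/presented_rel/Oq_rel_AB.
Qed.

Lemma Oq_BA : onsager_rel q OqB OqA = 0.
Proof.
rewrite -(onsager_rel_hom q (presented_pi Oq_rel_cst0)).
exact/presented_rel/Oq_rel_BA.
Qed.

End Onsager.

Section AskeyWilson.
Context (F : fieldType) (q : F).

Local Notation a := (free_gen F (0 : 'I_3)).
Local Notation b := (free_gen F (1 : 'I_3)).
Local Notation c := (free_gen F (2 : 'I_3)).

Variant Deltaq_rel : free_alg F 'I_3 -> Prop :=
| Deltaq_rel_A u : Deltaq_rel (aw_elt q a b c * u - u * aw_elt q a b c)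
| Deltaq_rel_B u : Deltaq_rel (aw_elt q b c a * u - u * aw_elt q b c a)
| Deltaq_rel_C u : Deltaq_rel (aw_elt q c a b * u - u * aw_elt q c a b).

Lemma Deltaq_rel_cst0 r : Deltaq_rel r -> r@_(fmone 'I_3) = 0.
Proof.
have eM := (@mcoeff1g_is_multiplicative (fmonom 'I_3) F).1.
have eC (u v : free_alg F 'I_3) : (u * v - v * u)@_(fmone 'I_3) = 0.
  apply: etrans (mcoeffB _ _ _) _; apply/eqP; rewrite subr_eq0; apply/eqP.
  exact: etrans (eM _ _) (etrans (mulrC _ _) (esym (eM _ _))).
by case=> u; apply: eC.
Qed.

Definition Deltaq := presented Deltaq_rel_cst0.
HB.instance Definition _ := GRing.Algebra.on Deltaq.

Definition DqA : Deltaq := presented_gen Deltaq_rel_cst0 0.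
Definition DqB : Deltaq := presented_gen Deltaq_rel_cst0 1.
Definition DqC : Deltaq := presented_gen Deltaq_rel_cst0 2.

Definition Dqalpha : Deltaq := (q + q^-1) *: aw_elt q DqA DqB DqC.
Definition Dqbeta : Deltaq := (q + q^-1) *: aw_elt q DqB DqC DqA.
Definition Dqgamma : Deltaq := (q + q^-1) *: aw_elt q DqC DqA DqB.

Definition DqOmega : Deltaq :=
  q *: (DqA * DqB * DqC) + q ^+ 2 *: DqA ^+ 2 + q ^- 2 *: DqB ^+ 2
  + q ^+ 2 *: DqC ^+ 2 - q *: (DqA * Dqalpha) - q^-1 *: (DqB * Dqbeta)
  - q *: (DqC * Dqgamma).

Let Deltaq_central (t : free_alg F 'I_3) :
    (forall u, Deltaq_rel (t * u - u * t)) ->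
  forall x : Deltaq,
    presented_pi Deltaq_rel_cst0 t * x = x * presented_pi Deltaq_rel_cst0 t.
Proof.
move=> tP x; have [u ->] := @presented_pi_surj _ _ _ Deltaq_rel_cst0 x.
exact/presented_comm/tP.
Qed.

Lemma Deltaq_centralA (x : Deltaq) :
  aw_elt q DqA DqB DqC * x = x * aw_elt q DqA DqB DqC.
Proof.
rewrite -(aw_elt_hom q (presented_pi Deltaq_rel_cst0)).
exact: Deltaq_central Deltaq_rel_A x.
Qed.

Lemma Deltaq_centralB (x : Deltaq) :
  aw_elt q DqB DqC DqA * x = x * aw_elt q DqB DqC DqA.
Proof.
rewrite -(aw_elt_hom q (presented_pi Deltaq_rel_cst0)).
exact: Deltaq_central Deltaq_rel_B x.
Qed.

Lemma Deltaq_centralC (x : Deltaq) :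
  aw_elt q DqC DqA DqB * x = x * aw_elt q DqC DqA DqB.
Proof.
rewrite -(aw_elt_hom q (presented_pi Deltaq_rel_cst0)).
exact: Deltaq_central Deltaq_rel_C x.
Qed.

End AskeyWilson.

(* T0i and T1i stand for the inverses of T_0 and T_1. *)
Section RootVectors.
Context (F : fieldType) (q : F) (T0i T1i : Oq q -> Oq q).

(* B_{n delta + alpha_1} *)
Definition Broot (n : nat) : Oq q :=
  iter n./2 (T1i \o T0i) (if odd n then T1i (OqA q) else OqB q).

(* B_{n delta}, for n >= 1 *)
Definition Bdelta (n : nat) : Oq q :=
  q ^- 2 *: (Broot n.-1 * OqA q) - OqA q * Broot n.-1
  + (q ^- 2 - 1) *: \sum_(l < n.-1) Broot l * Broot (n - l - 2).

End RootVectors.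

Arguments OqA {F q}.
Arguments OqB {F q}.
Arguments DqA {F q}.
Arguments DqB {F q}.
Arguments DqC {F q}.
Arguments Dqalpha {F q}.
Arguments Dqbeta {F q}.
Arguments Dqgamma {F q}.
Arguments DqOmega {F q}.

(* Main.v *)
Require Import Defs.
From HB Require Import structures.
From mathcomp Require Import all_boot all_order all_algebra.
From mathcomp Require Import ring boolp.
Set Implicit Arguments.
Unset Strict Implicit.
Import GRing.Theory.
Local Open Scope ring_scope.

(** Put [y 0 = A] and let [y n.+1] be the image of the root vector of index [n].
    In the Onsager algebra [y n.+2 = lusztig q^-1 (y n.+1) (y n)], because the
    inverses of [T_0] and [T_1] are given by the formula of [lusztig] with [q]
    inverted ([lusztig_onsager]) and [T_1^-1 T_0^-1] shifts the indices by two.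
    In the Askey-Wilson algebra this step turns a triple [(y n, y n.+1, C)]
    satisfying the defining relations into another such triple, with the same
    [C] and [gamma] and with [alpha] and [beta] exchanged ([aw_triple_step]).
    Hence multiplication by [C] acts on the [y n] by three-term rules:
      [C * y n.+1 = e_n - q y n.+2 - q^-1 y n],
      [y n.+1 * C = e_n - q^-1 y n.+2 - q y n],
    where [e_n] is [alpha] or [beta] according to the parity of [n].

    Pass to formal power series in a central variable [t]: let [x] have the
    coefficients [y n.+1], and [e] the coefficients [e_n].  With
      [L = 1 + q^-1 C t + q^-2 t^2] and [M = 1 + q C t + q^2 t^2]
    the three-term rules say that [L * x] and [x * M] are explicit expressions
    in [A], [B], [e] and [t].  The generating series of the elements in the
    theorem is
      [D = q^-2 t x A - t A x - (1 - q^-2) t^2 x^2].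
    Since [t] is central, [L * D * M] is a combination of [(L x) A M],
    [L A (x M)] and [(L x) (x M)], from which [x] can be eliminated.  As [e * (1 - t^2) = alpha + beta t], multiplying by
    [(1 - t^2)^2] leaves an identity between polynomials in [t], and its
    coefficients reduce, through three identities in the Askey-Wilson algebra, to
    central elements, [C] and the Casimir element ([aw_generating_identity]).

    On the other side, the series [W] with coefficients [(-1)^n [n+1]_q U_n(C)]
    satisfies [L * M * W = 1 - t^2] ([qcheby_seriesP]).  So [D], corrected by its
    constant term, and the product of [W] with [delta_factor], a series in [t]
    over the Casimir element and the central elements, agree after multiplication
    by [(1 - t^2)^2 * L] on the left and [M] on the right.  These series have
    constant term 1, hence cancel ([delta_series_factor]), and comparing
    coefficients gives the theorem.

    The finite identities are checked by normalising noncommutative polynomials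
    with scalar coefficients, some of whose variables are central. *)

(** * Normalisation in algebras with central elements *)

Definition central (A : nzRingType) (z : A) := forall x, z * x = x * z.

Fixpoint all_central (A : nzRingType) (zs : seq A) : Prop :=
  if zs is z :: zs' then central z /\ all_central zs' else True.

(** The first sort of variables ranges over arbitrary elements of the algebra,
    the second over central ones. *)
Inductive ncexpr (F : Type) : Type :=
| NCvar of nat
| NCcentral of nat
| NCzero
| NCone
| NCadd of ncexpr F & ncexpr F
| NCopp of ncexpr F
| NCmul of ncexpr F & ncexpr F
| NCscale of F & ncexpr F
| NCexp of ncexpr F & nat.
Arguments NCvar {F}.
Arguments NCcentral {F}.
Arguments NCzero {F}.
Arguments NCone {F}.

(** The comparison is built on [Nat.eqb] so that [lazy] can decide it with a
    short list of constants, leaving the scalars untouched. *)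
Fixpoint eqwordb (s t : seq nat) : bool :=
  match s, t with
  | [::], [::] => true
  | m :: s', n :: t' => if Nat.eqb m n then eqwordb s' t' else false
  | _, _ => false
  end.

Fixpoint addexp (s t : seq nat) : seq nat :=
  match s, t with
  | [::], _ => t
  | _, [::] => s
  | m :: s', n :: t' => Nat.add m n :: addexp s' t'
  end.

Fixpoint unitexp (k i : nat) : seq nat :=
  match k, i with
  | 0, _ => [::]
  | k'.+1, 0 => 1%N :: unitexp k' k'
  | k'.+1, i'.+1 => 0%N :: unitexp k' i'
  end.

Section Normalisation.
Context (F : fieldType).

(** A monomial is a word in the arbitrary variables together with the exponents
    of the central ones. *)
Definition ncterm : Type := F * (seq nat * seq nat).

Fixpoint ncmulterm (x : ncterm) (l : seq ncterm) : seq ncterm :=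
  if l is y :: l' then
    (x.1 * y.1, (x.2.1 ++ y.2.1, addexp x.2.2 y.2.2)) :: ncmulterm x l'
  else [::].

Fixpoint ncmul (l1 l2 : seq ncterm) : seq ncterm :=
  if l1 is x :: l1' then ncmulterm x l2 ++ ncmul l1' l2 else [::].

Fixpoint ncscale (c : F) (l : seq ncterm) : seq ncterm :=
  if l is x :: l' then (c * x.1, x.2) :: ncscale c l' else [::].

Fixpoint ncpow (one l : seq ncterm) (n : nat) : seq ncterm :=
  if n is n'.+1 then ncmul l (ncpow one l n') else one.

Fixpoint ncnorm (k : nat) (e : ncexpr F) : seq ncterm :=
  match e with
  | NCvar i => [:: (1, ([:: i], unitexp k k))]
  | NCcentral i => [:: (1, ([::], unitexp k i))]
  | NCzero => [::]
  | NCone => [:: (1, ([::], unitexp k k))]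
  | NCadd e1 e2 => ncnorm k e1 ++ ncnorm k e2
  | NCopp e1 => ncscale (- 1) (ncnorm k e1)
  | NCmul e1 e2 => ncmul (ncnorm k e1) (ncnorm k e2)
  | NCscale c e1 => ncscale c (ncnorm k e1)
  | NCexp e1 n => ncpow [:: (1, ([::], unitexp k k))] (ncnorm k e1) n
  end.

Fixpoint nccollect (m : seq nat * seq nat) (c : F) (l : seq ncterm) :
    F * seq ncterm :=
  if l is x :: l' then
    if (if eqwordb m.1 x.2.1 then eqwordb m.2 x.2.2 else false)
    then nccollect m (c + x.1) l'
    else let r := nccollect m c l' in (r.1, x :: r.2)
  else (c, [::]).

(** The sum of [l] vanishes if, monomial by monomial, the collected coefficients
    do.  Each round removes one monomial, so [size l] rounds are enough. *)
Fixpoint nczero (fuel : nat) (l : seq ncterm) : Prop :=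
  if fuel is n.+1 then
    if l is x :: l' then
      let r := nccollect x.2 x.1 l' in r.1 = 0 /\ nczero n r.2
    else True
  else l = [::].

Context (A : algType F) (env zenv : seq A).

Fixpoint nceval (e : ncexpr F) : A :=
  match e with
  | NCvar i => nth 0 env i
  | NCcentral i => nth 0 zenv i
  | NCzero => 0
  | NCone => 1
  | NCadd e1 e2 => nceval e1 + nceval e2
  | NCopp e1 => - nceval e1
  | NCmul e1 e2 => nceval e1 * nceval e2
  | NCscale c e1 => c *: nceval e1
  | NCexp e1 n => nceval e1 ^+ n
  end.

Fixpoint evalword (w : seq nat) : A :=
  if w is i :: w' then nth 0 env i * evalword w' else 1.

Fixpoint evalexp (zs : seq A) (s : seq nat) : A :=
  match zs, s with
  | z :: zs', n :: s' => z ^+ n * evalexp zs' s'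
  | _, _ => 1
  end.

Definition evalmon (m : seq nat * seq nat) : A :=
  evalword m.1 * evalexp zenv m.2.

Fixpoint evalterms (l : seq ncterm) : A :=
  if l is x :: l' then x.1 *: evalmon x.2 + evalterms l' else 0.

Fixpoint ncwf (k : nat) (e : ncexpr F) : bool :=
  match e with
  | NCvar _ | NCzero | NCone => true
  | NCcentral i => (i < k)%N
  | NCadd e1 e2 | NCmul e1 e2 => ncwf k e1 && ncwf k e2
  | NCopp e1 | NCscale _ e1 | NCexp e1 _ => ncwf k e1
  end.

Lemma eqwordP s t : eqwordb s t -> s = t.
Proof.
elim: s t => [|m s IH] [|n t] //=.
by case E: (Nat.eqb m n) => // /IH ->; move/PeanoNat.Nat.eqb_eq: E => ->.
Qed.

Lemma evalword_cat w1 w2 : evalword (w1 ++ w2) = evalword w1 * evalword w2.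
Proof. by elim: w1 => [|i w1 IH] /=; rewrite ?mul1r // IH mulrA. Qed.

Lemma central_exp (z : A) n : central z -> central (z ^+ n).
Proof. by move=> hz x; apply/commr_sym/commrX/commr_sym/hz. Qed.

Lemma evalexp_central zs s : all_central zs -> central (evalexp zs s).
Proof.
elim: zs s => [|z zs IH] [|n s] /=; try by move=> *; move=> x; rewrite mul1r mulr1.
by case=> hz hzs x; rewrite -mulrA IH // mulrA central_exp // mulrA.
Qed.

Lemma evalexp_add zs s t : all_central zs ->
  evalexp zs (addexp s t) = evalexp zs s * evalexp zs t.
Proof.
elim: zs s t => [|z zs IH] [|m s] [|n t] /=; rewrite ?mul1r ?mulr1 //.
case=> hz hzs; rewrite IH // exprD -!mulrA; congr (_ * _).
by rewrite !mulrA [_ * z ^+ n]evalexp_central.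
Qed.

Lemma evalexp_unit0 zs k : evalexp zs (unitexp k k) = 1.
Proof. by elim: k zs => [|k IH] [|z zs] //=; rewrite IH mul1r. Qed.

Lemma evalexp_unit zs k i : (i < k)%N -> size zs = k ->
  evalexp zs (unitexp k i) = nth 0 zs i.
Proof.
elim: zs k i => [|z zs IH] [|k] [|i] //=.
  by move=> _ _; rewrite expr1 evalexp_unit0 mulr1.
by move=> lt_ik [szs]; rewrite expr0 mul1r IH.
Qed.

Lemma evalterms_cat l1 l2 :
  evalterms (l1 ++ l2) = evalterms l1 + evalterms l2.
Proof. by elim: l1 => [|x l1 IH] /=; rewrite ?add0r // IH addrA. Qed.

Lemma evalterms_scale c l : evalterms (ncscale c l) = c *: evalterms l.
Proof.
by elim: l => [|x l IH] /=; rewrite ?scaler0 // IH scalerDr scalerA.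
Qed.

Context (zenvC : all_central zenv).

Lemma evalterms_multerm x l :
  evalterms (ncmulterm x l) = (x.1 *: evalmon x.2) * evalterms l.
Proof.
elim: l => [|y l IH] /=; first by rewrite mulr0.
rewrite IH mulrDr; congr (_ + _).
rewrite -scalerAl -scalerAr scalerA /evalmon /= evalword_cat evalexp_add //.
congr (_ *: _); rewrite -!mulrA; congr (_ * _).
by rewrite !mulrA [evalword _ * _](esym (evalexp_central _ _ _)).
Qed.

Lemma evalterms_mul l1 l2 :
  evalterms (ncmul l1 l2) = evalterms l1 * evalterms l2.
Proof.
elim: l1 => [|x l1 IH] /=; first by rewrite mul0r.
by rewrite evalterms_cat evalterms_multerm IH mulrDl.
Qed.

Lemma evalterms_one k : evalterms [:: (1, ([::], unitexp k k))] = 1.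
Proof. by rewrite /= /evalmon /= evalexp_unit0 scale1r mul1r addr0. Qed.

Lemma ncnormP e : ncwf (size zenv) e ->
  nceval e = evalterms (ncnorm (size zenv) e).
Proof.
elim: e => [i|i|||e1 IH1 e2 IH2|e1 IH|e1 IH1 e2 IH2|c e1 IH|e1 IH n] /=.
- by rewrite /evalmon /= evalexp_unit0 scale1r !mulr1 addr0.
- by move=> ik; rewrite /evalmon /= evalexp_unit // scale1r mul1r addr0.
- by [].
- by rewrite /evalmon /= evalexp_unit0 scale1r mul1r addr0.
- by case/andP=> h1 h2; rewrite evalterms_cat IH1 ?IH2.
- by move=> h; rewrite evalterms_scale scaleN1r IH.
- by case/andP=> h1 h2; rewrite evalterms_mul IH1 ?IH2.
- by move=> h; rewrite evalterms_scale IH.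
- move=> h; rewrite IH //; elim: n => [|n IHn]; first
    by rewrite expr0 -(evalterms_one (size zenv)).
  by rewrite exprS IHn -evalterms_mul.
Qed.

Lemma nccollectP m c l :
  c *: evalmon m + evalterms l =
  (nccollect m c l).1 *: evalmon m + evalterms (nccollect m c l).2.
Proof.
elim: l c => [//|[d [w s]] l IH] c /=.
case Ew: (eqwordb _ _); last by rewrite /= addrCA IH addrCA.
case Es: (eqwordb _ _); last by rewrite /= addrCA IH addrCA.
rewrite -IH scalerDl addrA /=.
by case: m Ew Es {IH} => [w' s'] /= /eqwordP -> /eqwordP ->.
Qed.

Lemma nczeroP fuel l : nczero fuel l -> evalterms l = 0.
Proof.
elim: fuel l => [|n IH] [|x l] //= [h1 /IH h2].
by rewrite nccollectP h1 h2 scale0r addr0.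
Qed.

Lemma ncringP e1 e2 :
    ncwf (size zenv) (NCadd e1 (NCopp e2)) ->
    (let l := ncnorm (size zenv) (NCadd e1 (NCopp e2)) in nczero (size l) l) ->
  nceval e1 = nceval e2.
Proof.
move=> wf /= /nczeroP h; apply/eqP; rewrite -subr_eq0; apply/eqP.
by rewrite -[LHS]/(nceval (NCadd e1 (NCopp e2))) ncnormP.
Qed.

End Normalisation.

Ltac nc_index x l :=
  lazymatch l with
  | x :: _ => constr:(0%N)
  | _ :: ?l' => let n := nc_index x l' in constr:(S n)
  | nil => fail
  end.

Ltac nc_reify F env zenv e :=
  match e with
  | _ => let i := nc_index e env in constr:(@NCvar F i)
  | _ => let i := nc_index e zenv in constr:(@NCcentral F i)
  | @GRing.one _ => constr:(@NCone F)
  | @GRing.zero _ => constr:(@NCzero F)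
  | @GRing.add _ ?x ?y =>
    let x' := nc_reify F env zenv x in
    let y' := nc_reify F env zenv y in constr:(NCadd x' y')
  | @GRing.opp _ ?x => let x' := nc_reify F env zenv x in constr:(NCopp x')
  | @GRing.mul _ ?x ?y =>
    let x' := nc_reify F env zenv x in
    let y' := nc_reify F env zenv y in constr:(NCmul x' y')
  | @GRing.scale _ _ ?c ?x =>
    let x' := nc_reify F env zenv x in constr:(@NCscale F c x')
  | @GRing.exp _ ?x ?n =>
    let x' := nc_reify F env zenv x in constr:(NCexp x' n)
  end.

(** Reduces an equation in the [F]-algebra [A], polynomial in the elements of
    [env] and the central elements of [zenv], to the vanishing of the scalar
    coefficient of each monomial. *)
Ltac ncring F A env zenv :=
  lazymatch goal with
  | |- ?x = ?y =>
    let x' := nc_reify F env zenv x in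
    let y' := nc_reify F env zenv y in
    apply: (@ncringP F A env zenv _ x' y');
    [ simpl all_central; repeat split; try assumption
    | reflexivity
    | lazy [ncnorm nczero nccollect ncmul ncmulterm ncscale ncpow addexp
            unitexp eqwordb Nat.eqb Nat.add size cat fst snd];
      repeat match goal with |- _ /\ _ => split end; try exact I ]
  end.

(** * Formal power series over an algebra *)

Definition pseries (A : Type) : Type := nat -> A.

Section PowerSeries.
Context (F : fieldType) (A : algType F).
Implicit Types f g h : pseries A.

HB.instance Definition _ := gen_eqMixin (pseries A).
HB.instance Definition _ := gen_choiceMixin (pseries A).

Definition pcoef f (n : nat) : A := f n.

Lemma pseriesP f g : pcoef f =1 pcoef g -> f = g.
Proof. by move=> fg; apply: funext. Qed.

Definition ps_add f g : pseries A := fun n => f n + g n.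
Definition ps_opp f : pseries A := fun n => - f n.
Definition ps_zero : pseries A := fun=> 0.

Let psaddA : associative ps_add.
Proof. by move=> f g h; apply: funext => n; apply: addrA. Qed.
Let psaddC : commutative ps_add.
Proof. by move=> f g; apply: funext => n; apply: addrC. Qed.
Let psadd0 : left_id ps_zero ps_add.
Proof. by move=> f; apply: funext => n; apply: add0r. Qed.
Let psaddN : left_inverse ps_zero ps_opp ps_add.
Proof. by move=> f; apply: funext => n; apply: addNr. Qed.

HB.instance Definition _ :=
  GRing.isZmodule.Build (pseries A) psaddA psaddC psadd0 psaddN.

Definition ps_const (a : A) : pseries A := fun n => if n is 0 then a else 0.
Definition ps_mul f g : pseries A := fun n => \sum_(i < n.+1) f i * g (n - i)%N.

Definition ps_trunc (N : nat) f : {poly A} := \poly_(i < N) f i.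

(** Convolution up to degree [n] is a product of polynomials; this gives its
    associativity. *)
Lemma ps_mul_trunc N f g n : (n < N)%N ->
  ps_mul f g n = (ps_trunc N f * ps_trunc N g)`_n.
Proof.
move=> nN; rewrite coefM; apply: eq_bigr => i _; rewrite !coef_poly.
by rewrite (leq_trans (ltn_ord i) nN) (leq_ltn_trans (leq_subr _ _) nN).
Qed.

Lemma coefM_eq (p p' r r' : {poly A}) n :
  (forall i, (i <= n)%N -> p`_i = p'`_i) ->
  (forall i, (i <= n)%N -> r`_i = r'`_i) -> (p * r)`_n = (p' * r')`_n.
Proof.
move=> hp hr; rewrite !coefM; apply: eq_bigr => i _.
by rewrite hp ?hr ?leq_subr // -ltnS.
Qed.

Let psmulA : associative ps_mul.
Proof.
move=> f g h; apply: funext => n; rewrite !(@ps_mul_trunc n.+1) //.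
pose T := ps_trunc n.+1.
have TM u v i : (i <= n)%N -> (T (ps_mul u v))`_i = (T u * T v)`_i.
  by move=> le_in; rewrite coef_poly ltnS le_in (@ps_mul_trunc n.+1).
transitivity ((T f * (T g * T h))`_n); first by apply: coefM_eq => // i /TM.
by rewrite mulrA; apply: coefM_eq => // i /TM.
Qed.

Let psmul1 : left_id (ps_const 1) ps_mul.
Proof.
move=> f; apply: funext => n; rewrite /ps_mul big_ord_recl /= mul1r subn0.
by rewrite big1 ?addr0 // => i _; rewrite mul0r.
Qed.

Let psmul_1 : right_id (ps_const 1) ps_mul.
Proof.
move=> f; apply: funext => n; rewrite /ps_mul big_ord_recr /= subnn mulr1.
rewrite big1 ?add0r // => i _; rewrite /ps_const.
by rewrite -[(n - i)%N]prednK ?subn_gt0 ?mulr0.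
Qed.

Let psmulDl : left_distributive ps_mul +%R.
Proof.
move=> f g h; apply: funext => n; rewrite -[RHS]big_split /=.
by apply: eq_bigr => i _; apply: mulrDl.
Qed.

Let psmulDr : right_distributive ps_mul +%R.
Proof.
move=> f g h; apply: funext => n; rewrite -[RHS]big_split /=.
by apply: eq_bigr => i _; apply: mulrDr.
Qed.

Let psone_neq0 : ps_const 1 != 0.
Proof.
apply/eqP => /(congr1 (fun f => pcoef f 0)) /eqP.
by apply/negP; apply: oner_neq0.
Qed.

HB.instance Definition _ := GRing.Zmodule_isNzRing.Build (pseries A)
  psmulA psmul1 psmul_1 psmulDl psmulDr psone_neq0.

Definition ps_scale (c : F) f : pseries A := fun n => c *: f n.

Let psscaleA c d f : ps_scale c (ps_scale d f) = ps_scale (c * d) f.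
Proof. by apply: funext => n; apply: scalerA. Qed.
Let psscale1 : left_id 1 ps_scale.
Proof. by move=> f; apply: funext => n; apply: scale1r. Qed.
Let psscaleDr : right_distributive ps_scale +%R.
Proof. by move=> c f g; apply: funext => n; apply: scalerDr. Qed.
Let psscaleDl f : {morph ps_scale^~ f : c d / c + d}.
Proof. by move=> c d; apply: funext => n; apply: scalerDl. Qed.

HB.instance Definition _ := GRing.Zmodule_isLmodule.Build F (pseries A)
  psscaleA psscale1 psscaleDr psscaleDl.

Let psscaleAl (c : F) f g : c *: (f * g) = c *: f * g.
Proof.
apply: funext => n; apply: etrans (scaler_sumr _ _ _ _) _.
by apply: eq_bigr => i _; apply: scalerAl.
Qed.

HB.instance Definition _ := GRing.Lmodule_isLalgebra.Build F (pseries A)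
  psscaleAl.

Let psscaleAr (c : F) f g : c *: (f * g) = f * (c *: g).
Proof.
apply: funext => n; apply: etrans (scaler_sumr _ _ _ _) _.
by apply: eq_bigr => i _; apply: scalerAr.
Qed.

HB.instance Definition _ := GRing.Lalgebra_isAlgebra.Build F (pseries A)
  psscaleAr.

Lemma pcoefD f g n : pcoef (f + g) n = pcoef f n + pcoef g n.
Proof. by []. Qed.
Lemma pcoefN f n : pcoef (- f) n = - pcoef f n.
Proof. by []. Qed.
Lemma pcoefZ c f n : pcoef (c *: f) n = c *: pcoef f n.
Proof. by []. Qed.
Lemma pcoefM f g n :
  pcoef (f * g) n = \sum_(i < n.+1) pcoef f i * pcoef g (n - i)%N.
Proof. by []. Qed.
Lemma pcoef1 n : pcoef 1 n = (n == 0%N)%:R.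
Proof. by case: n. Qed.
Lemma pcoef_const a n : pcoef (ps_const a) n = if n is 0 then a else 0.
Proof. by []. Qed.

Definition ps_var : pseries A := fun n => (n == 1%N)%:R.
Local Notation t := ps_var.

Lemma pcoef_constM a f n : pcoef (ps_const a * f) n = a * pcoef f n.
Proof.
rewrite pcoefM big_ord_recl /= subn0 pcoef_const big1 ?addr0 // => i _.
by rewrite mul0r.
Qed.

Lemma pcoefM_const a f n : pcoef (f * ps_const a) n = pcoef f n * a.
Proof.
rewrite pcoefM big_ord_recr /= subnn pcoef_const big1 ?add0r // => i _.
by rewrite pcoef_const -[(n - i)%N]prednK ?subn_gt0 ?mulr0.
Qed.

Lemma pcoef_varM0 f : pcoef (t * f) 0 = 0.
Proof. by rewrite pcoefM big_ord1 mul0r. Qed.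

Lemma pcoef_varMS f n : pcoef (t * f) n.+1 = pcoef f n.
Proof.
rewrite pcoefM 2!big_ord_recl /= big1 ?addr0; last by move=> i _; rewrite mul0r.
by rewrite mul0r add0r mul1r subn1.
Qed.

Lemma ps_var_central : central t.
Proof.
move=> f; apply: pseriesP => -[|n].
  by rewrite pcoef_varM0 pcoefM big_ord1 mulr0.
rewrite pcoef_varMS pcoefM 2!big_ord_recr /=.
rewrite subSn // !subnn -[pcoef t 0]/(0 : A) -[pcoef t 1]/(1 : A).
rewrite mulr0 addr0 mulr1.
rewrite big1 ?add0r // => i _.
by rewrite /pcoef /t subSn ?(ltnW (ltn_ord i)) // eqSS subn_eq0 leqNgt ltn_ord mulr0.
Qed.

Lemma pcoef_varXM j f n :
  pcoef (t ^+ j * f) n = if (j <= n)%N then pcoef f (n - j) else 0.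
Proof.
elim: j n => [|j IH] n; first by rewrite expr0 mul1r subn0.
rewrite exprS -mulrA; case: n => [|n]; first by rewrite pcoef_varM0.
by rewrite pcoef_varMS IH.
Qed.

Lemma ps_constD a b : ps_const (a + b) = ps_const a + ps_const b.
Proof. by apply: pseriesP => -[|n] //; rewrite pcoefD !pcoef_const addr0. Qed.
Lemma ps_constN a : ps_const (- a) = - ps_const a.
Proof. by apply: pseriesP => -[|n] //; rewrite pcoefN !pcoef_const oppr0. Qed.
Lemma ps_constM a b : ps_const (a * b) = ps_const a * ps_const b.
Proof. by apply: pseriesP => -[|n]; rewrite pcoef_constM // mulr0. Qed.
Lemma ps_constZ c a : ps_const (c *: a) = c *: ps_const a.
Proof. by apply: pseriesP => -[|n] //; rewrite pcoefZ !pcoef_const scaler0. Qed.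

Lemma ps_const_central a : central a -> central (ps_const a).
Proof.
by move=> ha f; apply: pseriesP => n; rewrite pcoef_constM pcoefM_const ha.
Qed.

(** If the constant term is 1, the coefficients of [g] are determined by those
    of [f * g] recursively. *)
Lemma ps_lreg f : pcoef f 0 = 1 -> GRing.lreg f.
Proof.
move=> f0 g h fgh; apply: pseriesP; elim/ltn_ind => n IH.
have := congr1 (fun u => pcoef u n) fgh; rewrite !pcoefM !big_ord_recl f0 /=.
rewrite !mul1r subn0 => /(canRL (addrK _)) ->; rewrite -addrA.
set s := (X in _ + X); suff -> : s = 0 by rewrite addr0.
apply/eqP; rewrite subr_eq0; apply/eqP; apply: eq_bigr => i _ /=.
rewrite IH // /bump add1n; case: n i {s IH} => [[]//|n i].
by rewrite subSS ltnS leq_subr.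
Qed.

Lemma ps_rreg f : pcoef f 0 = 1 -> GRing.rreg f.
Proof.
move=> f0 g h gfh; apply: pseriesP; elim/ltn_ind => n IH.
have := congr1 (fun u => pcoef u n) gfh; rewrite /= !pcoefM !big_ord_recr /=.
rewrite subnn f0 !mulr1 => /(canRL (addKr _)) ->; rewrite addrA.
set s := (X in X + _); suff -> : s = 0 by rewrite add0r.
apply/eqP; rewrite /s addrC subr_eq0; apply/eqP; apply: eq_bigr => i _ /=.
by rewrite IH.
Qed.

End PowerSeries.

(** * Scalars *)

(** Every denominator below is, up to a power of [q], a product of factors of
    [q ^+ 4 - 1]. *)
Lemma factor_neq0 (F : fieldType) (q x k : F) :
  q ^+ 4 != 1 -> q ^+ 4 - 1 = x * k -> x != 0.
Proof.
by move=> q4 E; apply: contraNneq q4 => x0; rewrite -subr_eq0 E x0 mul0r.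
Qed.

Ltac qfield q0 q4 :=
  field;
  repeat match goal with |- is_true (_ && _) => apply/andP; split end;
  first [ exact: q0 | exact: oner_neq0 | exact: erefl
        | apply: (factor_neq0 (k := 1) q4); ring
        | apply: (factor_neq0 (k := -1) q4); ring
        | match type of q0 with is_true (?q != 0) =>
            first [ apply: (factor_neq0 (k := q ^+ 2 + 1) q4); ring
                  | apply: (factor_neq0 (k := - (q ^+ 2 + 1)) q4); ring
                  | apply: (factor_neq0 (k := q ^+ 2 - 1) q4); ring ] end ].

Lemma qint2 (F : fieldType) (q : F) : q != 0 -> q ^+ 4 != 1 ->
  qint q 2 = q + q^-1.
Proof.
move=> q0 q4; rewrite /qint -[q ^ 2]/(q ^+ 2) -[q ^ (- 2)]/(q ^- 2).
by qfield q0 q4.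
Qed.

Lemma qint3 (F : fieldType) (q : F) : q != 0 -> q ^+ 4 != 1 ->
  qint q 3 = q ^+ 2 + 1 + q ^- 2.
Proof.
move=> q0 q4; rewrite /qint -[q ^ 3]/(q ^+ 3) -[q ^ (- 3)]/(q ^- 3).
by qfield q0 q4.
Qed.

(** * Identities in the Askey-Wilson algebra *)

(** The three defining relations of the universal Askey-Wilson algebra, solved
    for the [q]-commutators: [al], [be] and [ga] are in the places of alpha, beta
    and gamma. *)
Definition aw_triple (F : fieldType) (q : F) (A : algType F)
    (a b c al be ga : A) : Prop :=
  [/\ q *: (b * c) - q^-1 *: (c * b) =
        (q - q^-1) *: al - (q ^+ 2 - q ^- 2) *: a,
      q *: (c * a) - q^-1 *: (a * c) =
        (q - q^-1) *: be - (q ^+ 2 - q ^- 2) *: b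
    & q *: (a * b) - q^-1 *: (b * a) =
        (q - q^-1) *: ga - (q ^+ 2 - q ^- 2) *: c].

Section AskeyWilsonRelations.
Context (F : fieldType) (q : F) (q0 : q != 0) (A : algType F).
Context (a b c al be ga : A).
Context (alC : central al) (beC : central be) (gaC : central ga).
Context (ra : q *: (b * c) - q^-1 *: (c * b) =
  (q - q^-1) *: al - (q ^+ 2 - q ^- 2) *: a).
Context (rb : q *: (c * a) - q^-1 *: (a * c) =
  (q - q^-1) *: be - (q ^+ 2 - q ^- 2) *: b).
Context (rc : q *: (a * b) - q^-1 *: (b * a) =
  (q - q^-1) *: ga - (q ^+ 2 - q ^- 2) *: c).

Definition aw_casimir : A :=
  q *: (a * b * c) + q ^+ 2 *: a ^+ 2 + q ^- 2 *: b ^+ 2 + q ^+ 2 *: c ^+ 2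
  - q *: (a * al) - q^-1 *: (b * be) - q *: (c * ga).

Local Ltac nc := ncring F A [:: a; b; c] [:: al; be; ga]; try by field.

(** The three identities below are the coefficients of [t], [t ^+ 2] and
    [t ^+ 3] in the generating identity; each follows by eliminating the products
    [b * a], [c * a] and [c * b] in favour of the opposite ones. *)
Lemma aw_linear_eq :
  q ^- 2 *: (b * a) - a * b = (1 - q ^- 2) *: ((q + q^-1) *: c - ga).
Proof.
transitivity (- q^-1 *: (q *: (a * b) - q^-1 *: (b * a))); first by nc.
by rewrite rc; nc.
Qed.

Lemma aw_quadratic_eq :
  q^-1 *: (b * a * c - c * a * b) + (q ^+ 2 - q ^- 4) *: a ^+ 2
    - (1 - q ^- 2) *: b ^+ 2 =
  (1 - q ^- 2) *: (aw_casimir + c ^+ 2 + (q + q^-1) *: (a * al)).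
Proof.
rewrite /aw_casimir.
transitivity ((q - q ^- 1) *: (a * b * c)
  - (q *: (a * b) - q^-1 *: (b * a)) * c
  - q ^- 2 *: ((q *: (c * a) - q^-1 *: (a * c)) * b)
  + q ^- 2 *: (a * (q *: (b * c) - q^-1 *: (c * b)))
  + (q ^+ 2 - q ^- 4) *: a ^+ 2 - (1 - q ^- 2) *: b ^+ 2); first by nc.
by rewrite ra rb rc; nc.
Qed.

Lemma aw_cubic_eq :
  q ^+ 2 *: (b * a) - q ^- 4 *: (a * b) + q *: (c * a ^+ 2)
    - q ^- 3 *: (a ^+ 2 * c) =
  (1 - q ^- 2) *: ((q + q^-1) *: c - ga + (q + q^-1) *: (a * be)).
Proof.
transitivity (q ^+ 2 *: (b * a) - q ^- 4 *: (a * b)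
  + (q *: (c * a) - q^-1 *: (a * c)) * a
  + q ^- 2 *: (a * (q *: (c * a) - q^-1 *: (a * c)))); first by nc.
rewrite rb; transitivity (q ^- 2 *: (b * a) - a * b
  + (q - q ^- 3) *: (a * be)); first by nc.
by rewrite aw_linear_eq; nc.
Qed.

(** The closed formula only involves [c], the Casimir element and central
    elements, so this makes its generating series commute with [L] and [M]. *)
Lemma aw_casimir_comm : aw_casimir * c = c * aw_casimir.
Proof.
apply/esym/eqP; rewrite -subr_eq0; apply/eqP; rewrite /aw_casimir.
pose za := q *: (b * c) - q^-1 *: (c * b)
  - ((q - q^-1) *: al - (q ^+ 2 - q ^- 2) *: a).
pose zb := q *: (c * a) - q^-1 *: (a * c)
  - ((q - q^-1) *: be - (q ^+ 2 - q ^- 2) *: b).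
have za0 : za = 0 by rewrite /za ra subrr.
have zb0 : zb = 0 by rewrite /zb rb subrr.
(* Moving [c] through each monomial of the Casimir element costs one of the
   relations [za], [zb]; the corrections add up to this combination. *)
transitivity (zb * (b * c) - a * za * c - al * zb + be * za
  + q *: (zb * a) + q^-1 *: (a * zb) - q *: (b * za) - q^-1 *: (za * b)).
  by rewrite /za /zb; nc.
by rewrite za0 zb0 !(mulr0, mul0r, scaler0, addr0, subr0).
Qed.

Context (t e x : A) (tC : central t) (eC : central e).
Context (et : e * (1 - t ^+ 2) = al + t * be).

Let L : A := 1 + q^-1 *: (t * c) + q ^- 2 *: t ^+ 2.
Let M : A := 1 + q *: (t * c) + q ^+ 2 *: t ^+ 2.

Context (Lx : L * x = b + q^-1 *: (t * e) - q ^- 2 *: (t * a)).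
Context (xM : x * M = b + q *: (t * e) - q ^+ 2 *: (t * a)).

Local Ltac nct :=
  ncring F A [:: a; b; c; x] [:: al; be; ga; t; e]; try by field.

(** The factors [L] and [M] absorb the two occurrences of [x], after which only
    [a], [b], [c], the central series [e] and [t] are left; [(1 - t ^+ 2) ^+ 2]
    clears the denominators of [e] and of its square. *)
Lemma aw_generating_identity :
  (1 - t ^+ 2) ^+ 2 * (L * (q ^- 2 *: (t * x * a) - t * a * x
    + (q ^- 2 - 1) *: (t ^+ 2 * x * x) - (1 - q ^- 2) *: 1) * M) =
  (1 - q ^- 2) *: ((1 - t ^+ 2) ^+ 2 * (aw_casimir * t ^+ 2
      - ga * t * (1 + t ^+ 2)
      - (1 + (q ^+ 2 + 1 + q ^- 2) *: t ^+ 2) * (1 - t ^+ 2)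
      - (q + q^-1) ^+ 2 *: t ^+ 4)
    - al * be * t ^+ 3 * (1 + t ^+ 2) - (al ^+ 2 + be ^+ 2) * t ^+ 4).
Proof.
transitivity ((1 - t ^+ 2) ^+ 2 * (q ^- 2 *: (t * (L * x) * a * M)
    - t * L * a * (x * M) - (1 - q ^- 2) *: (t ^+ 2 * (L * x) * (x * M))
    - (1 - q ^- 2) *: (L * M))).
  by rewrite /L /M; nct.
rewrite Lx xM.
(* Collect by degree in [t] the terms without [e], then those linear and those
   quadratic in [e]. *)
transitivity ((1 - t ^+ 2) ^+ 2 * (t * (q ^- 2 *: (b * a) - a * b)
    + t ^+ 2 * (q^-1 *: (b * a * c - c * a * b) + (q ^+ 2 - q ^- 4) *: a ^+ 2
                 - (1 - q ^- 2) *: b ^+ 2)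
    + t ^+ 3 * (q ^+ 2 *: (b * a) - q ^- 4 *: (a * b) + q *: (c * a ^+ 2)
                 - q ^- 3 *: (a ^+ 2 * c))
    - (1 - q ^- 2) *: (L * M))
  + (e * (1 - t ^+ 2)) * (t ^+ 2 * (1 - t ^+ 2)
      * ((q ^- 3 - q) *: (a * (1 - t ^+ 2))
        - q^-1 *: (t * (q *: (c * a) - q^-1 *: (a * c)))
        - (q - q ^- 3) *: (t * b)))
  - (1 - q ^- 2) *: ((e * (1 - t ^+ 2)) * (e * (1 - t ^+ 2)) * t ^+ 4)).
  by rewrite /L /M; nct.
rewrite et rb aw_linear_eq aw_quadratic_eq aw_cubic_eq /aw_casimir /L /M.
nct.
Qed.

End AskeyWilsonRelations.

(** * The root vectors *)

(** Let [l] and [r] be left and right multiplication by [a], and [k] the inverse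
    of [(q - q^-1) * (q ^+ 2 - q ^- 2)].  The two transformations of [b] are
    [1 + k (l - r) (q l - q^-1 r)] and the same with [q] inverted; their product
    differs from the identity by [k ^+ 2 (l - r)] applied to the Onsager relation,
    whose cubic part is
    [(l - r) (l ^+ 2 - (q ^+ 2 + q ^- 2) l r + r ^+ 2)]. *)
Lemma lusztig_onsager (F : fieldType) (q : F) (A : algType F) (a b : A) :
  q != 0 -> q ^+ 4 != 1 ->
  lusztig q^-1 a (lusztig q a b) = b + ((q - q^-1) * (q ^+ 2 - q ^- 2)) ^- 2
    *: (a * onsager_rel q a b - onsager_rel q a b * a).
Proof.
move=> q0 q4; rewrite /lusztig /onsager_rel qint3 //.
by ncring F A [:: a; b] (@nil A); qfield q0 q4.
Qed.

(** By the relation between [a] and [b], the new element is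
    [a + (b * c - c * b) / (q - q^-1)].  It is obtained from the relation
    expressing [a] by exchanging the factors [b] and [c].  The other two relations
    of the new triple follow because [al] commutes with [b] and with [c]. *)
Lemma aw_triple_step (F : fieldType) (q : F) (A : algType F)
    (a b c al be ga : A) : q != 0 -> q ^+ 4 != 1 ->
  central al -> central be -> central ga -> 
  aw_triple q a b c al be ga -> aw_triple q b (lusztig q^-1 b a) c be al ga.
Proof.
move=> q0 q4 alC beC gaC [ra rb rc].
have -> : lusztig q^-1 b a = a + (q - q^-1)^-1 *: (b * c - c * b).
  transitivity (a - ((q - q^-1) * (q ^+ 2 - q ^- 2))^-1 *:
     (b * (q *: (a * b) - q^-1 *: (b * a))
      - (q *: (a * b) - q^-1 *: (b * a)) * b)).
    by rewrite /lusztig; ncring F A [:: a; b] (@nil A); qfield q0 q4.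
  by rewrite rc; ncring F A [:: a; b; c] [:: ga]; qfield q0 q4.
pose za := q *: (b * c) - q^-1 *: (c * b)
  - ((q - q^-1) *: al - (q ^+ 2 - q ^- 2) *: a).
have za0 : za = 0 by rewrite /za ra subrr.
split.
- transitivity (q *: (c * a) - q^-1 *: (a * c)
    + (q - q^-1)^-1 *: (za * c - c * za)); last first.
    by rewrite rb za0 mulr0 mul0r subrr scaler0 addr0.
  by rewrite /za; ncring F A [:: a; b; c] [:: al]; qfield q0 q4.
- transitivity ((q - q^-1) *: al - (q ^+ 2 - q ^- 2) *: (a + (q - q^-1)^-1
    *: (b * c - c * b)) + za : A); last by rewrite za0 addr0.
  by rewrite /za; ncring F A [:: a; b; c] [:: al]; qfield q0 q4.
- transitivity (q *: (a * b) - q^-1 *: (b * a)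
    + (q - q^-1)^-1 *: (b * za - za * b)); last first.
    by rewrite rc za0 mulr0 mul0r subrr scaler0 addr0.
  by rewrite /za; ncring F A [:: a; b; c] [:: al]; qfield q0 q4.
Qed.

(** The relation expressing [a] and the one expressing [b'] are two linear
    equations for [b * c] and [c * b], of determinant [q ^+ 2 - q ^- 2]. *)
Lemma aw_triple_mul (F : fieldType) (q : F) (A : algType F)
    (a b b' c al be ga : A) : q != 0 -> q ^+ 4 != 1 ->
  aw_triple q a b c al be ga -> aw_triple q b b' c be al ga ->
  c * b = al - q *: b' - q^-1 *: a /\ b * c = al - q^-1 *: b' - q *: a.
Proof.
move=> q0 q4 [ra _ _] [_ ra' _].
pose k := ((q ^+ 2 - q ^- 2))^-1.
split.
- transitivity (k *: (q *: (q *: (c * b) - q^-1 *: (b * c))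
    + q^-1 *: (q *: (b * c) - q^-1 *: (c * b)))).
    by rewrite /k; ncring F A [:: b; c] (@nil A); qfield q0 q4.
  by rewrite ra ra' /k; ncring F A [:: a; b'; al] (@nil A); qfield q0 q4.
- transitivity (k *: (q^-1 *: (q *: (c * b) - q^-1 *: (b * c))
    + q *: (q *: (b * c) - q^-1 *: (c * b)))).
    by rewrite /k; ncring F A [:: b; c] (@nil A); qfield q0 q4.
  by rewrite ra ra' /k; ncring F A [:: a; b'; al] (@nil A); qfield q0 q4.
Qed.

Lemma lusztig_hom (F : fieldType) (q : F) (A B : algType F)
    (f : {lrmorphism A -> B}) (a b : A) :
  f (lusztig q a b) = lusztig q (f a) (f b).
Proof.
have fD u v : f (u + v) = f u + f v by exact: raddfD.
have fN u : f (- u) = - f u by exact: raddfN.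
have fZ (d : F) u : f (d *: u) = d *: f u by exact: linearZ.
by rewrite /lusztig !(fD, fN, fZ, rmorphM, rmorphXn).
Qed.

Lemma cancel_lusztig (F : fieldType) (q : F) (A : algType F)
    (T Ti : {lrmorphism A -> A}) (a b : A) :
  q != 0 -> q ^+ 4 != 1 -> cancel T Ti ->
  T a = a -> T b = lusztig q a b -> onsager_rel q a b = 0 ->
  Ti a = a /\ Ti b = lusztig q^-1 a b.
Proof.
move=> q0 q4 TK Ta Tb rel; have Tia : Ti a = a by rewrite -{1}Ta TK.
split=> //; rewrite -[RHS]TK; congr (Ti _).
by rewrite lusztig_hom Ta Tb lusztig_onsager // rel mulr0 mul0r subrr scaler0 addr0.
Qed.

(** The composite [S1 \o S0] moves the index by two and commutes with [lusztig],
    so the recurrence has to be checked only for the first two indices. *)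
Lemma iter_lusztig_rec (F : fieldType) (q : F) (A : algType F)
    (S0 S1 : {lrmorphism A -> A}) (a b : A) :
    S0 a = a -> S0 b = lusztig q a b -> S1 b = b -> S1 a = lusztig q b a ->
  let z n := iter n./2 (S1 \o S0) (if odd n then b else a) in
  forall n, z n.+2 = lusztig q (z n.+1) (z n).
Proof.
move=> S0a S0b S1b S1a z n.
have zE m : z m.+2 = S1 (S0 (z m)) by rewrite /z /= negbK.
have: z n.+2 = lusztig q (z n.+1) (z n) /\ z n.+3 = lusztig q (z n.+2) (z n.+1).
  elim: n => [|n [IH1 IH2]]; last first.
    by split=> //; rewrite [LHS]zE [in LHS]IH1 !lusztig_hom -!zE.
  rewrite !zE -[z 0%N]/a -[z 1%N]/b S0a S0b S1a; split=> //.
  by rewrite lusztig_hom S1b S1a.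
by case.
Qed.

Lemma Broot_iter (F : fieldType) (q : F) (T0i T1i : Oq q -> Oq q) (n : nat) :
  T0i OqA = OqA ->
  iter n.+1./2 (T1i \o T0i) (if odd n.+1 then OqB else OqA) = Broot T0i T1i n.
Proof.
move=> T0iA; rewrite /Broot /= uphalf_half; case: odd => //.
by rewrite add1n iterSr /= T0iA.
Qed.

(** * Rational series in the square of the variable *)

Lemma cube_mull (R : nzRingType) (u v : R) : v ^+ 3 * u = v * (v * (v * u)).
Proof. by rewrite exprS expr2 -!mulrA. Qed.

Section EvenSeries.
Context (F : fieldType) (A : algType F).
Implicit Types (k : nat -> F) (f : pseries A).
Local Notation t := (ps_var A).

Definition ps_even k : pseries A := fun n => if odd n then 0 else (k n./2)%:A.

Lemma pcoef_even k n :
  pcoef (ps_even k) n = if odd n then 0 else (k n./2)%:A.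
Proof. by []. Qed.

Lemma eq_ps_even k1 k2 : k1 =1 k2 -> ps_even k1 = ps_even k2.
Proof. by move=> k12; apply: pseriesP => n; rewrite !pcoef_even k12. Qed.

Lemma ps_even_rec k :
  ps_even k = (k 0%N)%:A + t ^+ 2 * ps_even (fun l => k l.+1).
Proof.
apply: pseriesP => n; rewrite pcoefD pcoefZ pcoef1 pcoef_varXM pcoef_even.
case: n => [|[|n]]; rewrite ?addr0 ?scaler0 //.
by rewrite pcoef_even add0r subSS subSS subn0 /= negbK.
Qed.

Lemma ps_even0 : ps_even (fun=> 0) = 0.
Proof. by apply: pseriesP => n; rewrite pcoef_even scale0r if_same. Qed.

Lemma ps_even_central k : central (ps_even k).
Proof.
move=> f; apply: pseriesP => n; rewrite !pcoefM (reindex_inj rev_ord_inj) /=.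
apply: eq_bigr => i _; rewrite subSS subKn ?leq_ord // pcoef_even.
by case: ifP => _; rewrite ?mul0r ?mulr0 // -scalerAl -scalerAr mul1r mulr1.
Qed.

(** Multiplication by [1 - t ^+ 2] takes differences of coefficients, so the
    closed forms below come from iterated differences of [1], ['C(l + 1, 2)] and
    [l ^ 2]. *)
Lemma ps_evenB k :
  (1 - t ^+ 2) * ps_even k =
  ps_even (fun l => if l is l'.+1 then k l'.+1 - k l' else k 0%N).
Proof.
apply: pseriesP => n; rewrite mulrBl mul1r pcoefD pcoefN pcoef_varXM !pcoef_even.
case: n => [|[|n]]; rewrite ?subr0 //=.
rewrite subSS subSS subn0 negbK.
by case: ifP; rewrite ?subr0 // scalerBl.
Qed.

Lemma pcoef_evenM k f n m : (n < m.*2)%N ->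
  pcoef (ps_even k * f) n =
  \sum_(l < m) if (l.*2 <= n)%N then k l *: pcoef f (n - l.*2) else 0.
Proof.
elim: m n k => [|m IH] n k //; rewrite doubleS big_ord_recl /= subn0 => nm.
rewrite {1}ps_even_rec mulrDl pcoefD -scalerAl mul1r pcoefZ -mulrA pcoef_varXM.
congr (_ + _); case: ifP => [n2|]; last first.
  move/negbT; rewrite -ltnNge => n2; rewrite big1 // => l _.
  by rewrite /bump /= add1n doubleS leqNgt (leq_trans n2).
rewrite IH; last by rewrite ltn_subLR ?add2n.
apply: eq_bigr => l _; rewrite /bump /= add1n doubleS.
by rewrite leq_subRL // -subnDA !add2n.
Qed.

Lemma ps_even1 : (1 - t ^+ 2) * ps_even (fun=> 1) = 1.
Proof.
rewrite ps_evenB ps_even_rec scale1r.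
rewrite (@eq_ps_even _ (fun=> 0)) => [|l]; last by rewrite /= subrr.
by rewrite ps_even0 mulr0 addr0.
Qed.

Lemma ps_even_bin2 :
  (1 - t ^+ 2) ^+ 3 * ps_even (fun l => 'C(l.+1, 2)%:R) = t ^+ 2.
Proof.
rewrite cube_mull ps_evenB.
rewrite (@eq_ps_even _ (fun l => l%:R)) => [|[|l]] //; last first.
  by rewrite binS natrD addrAC subrr add0r bin1.
rewrite ps_evenB ps_even_rec scale0r add0r.
rewrite (@eq_ps_even _ (fun=> 1)) => [|l]; last by rewrite -natrB // subSnn.
rewrite mulrA -(central_exp 2 (@ps_var_central F A)) -mulrA ps_even1.
by rewrite mulr1.
Qed.

Lemma ps_even_sqr :
  (1 - t ^+ 2) ^+ 3 * ps_even (fun l => l%:R ^+ 2) = t ^+ 2 * (1 + t ^+ 2).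
Proof.
rewrite cube_mull !ps_evenB.
rewrite (@eq_ps_even _ (fun l => (0 < l < 3)%N%:R)); last first.
  by case=> [|[|[|l]]] /=; rewrite -?natr1 ?mulr0n ?mulr1n; ring.
rewrite 3!ps_even_rec (@eq_ps_even _ (fun=> 0)) // ps_even0.
by rewrite /= mulr0n mulr1n scale0r !scale1r mulr0 addr0 add0r mulr1.
Qed.
End EvenSeries.

(** * The series of Chebyshev polynomials *)

Section ChebyshevSeries.
Context (F : fieldType) (q : F) (q0 : q != 0) (q4 : q ^+ 4 != 1).
Context (A : algType F) (c : A).
Local Notation t := (ps_var A).

Definition cheby_at (n : int) : A := horner_alg c (chebyU F n).

Lemma cheby_at_rec (n : nat) :
  cheby_at n.+2 = c * cheby_at n.+1 - cheby_at n.
Proof. by rewrite /cheby_at /chebyU /= rmorphB rmorphM /= horner_algX. Qed.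

Lemma cheby_at_comm (n : int) (u : A) :
  u * c = c * u -> u * cheby_at n = cheby_at n * u.
Proof.
move=> uc; case: n => [n|n]; last by rewrite /cheby_at !rmorph0 mulr0 mul0r.
have: u * cheby_at n = cheby_at n * u /\ u * cheby_at n.+1 = cheby_at n.+1 * u.
  elim: n => [|n [IH0 IH1]].
    by rewrite /cheby_at /= rmorph1 horner_algX mulr1 mul1r.
  by split=> //; rewrite cheby_at_rec mulrBr mulrBl IH0 mulrA uc -!mulrA IH1.
by case.
Qed.

Definition cheby_series (z : F) : pseries A :=
  fun n => (- z) ^+ n *: cheby_at n.

Lemma cheby_seriesP z :
  (1 + z *: (t * ps_const c) + z ^+ 2 *: t ^+ 2) * cheby_series z = 1.
Proof.
apply: pseriesP => n; rewrite !mulrDl mul1r -!scalerAl -mulrA.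
rewrite !pcoefD !pcoefZ pcoef_varXM pcoef1.
have coefC m : pcoef (cheby_series z) m = (- z) ^+ m *: cheby_at m by [].
have c0 : cheby_at 0%N = 1 by rewrite /cheby_at rmorph1.
have c1 : cheby_at 1%N = c by rewrite /cheby_at horner_algX.
case: n => [|[|n]].
- by rewrite pcoef_varM0 !scaler0 !addr0 coefC c0 scale1r.
- rewrite pcoef_varMS pcoef_constM !coefC c0 c1 scaler0 addr0.
  by rewrite expr0 scale1r mulr1 -scalerDl addNr scale0r.
- rewrite pcoef_varMS pcoef_constM /= subSS subSS subn0 mulr0n !coefC cheby_at_rec.
  move: (cheby_at n.+1) (cheby_at n) => u v.
  by rewrite !exprS; ncring F A [:: c; u; v] (@nil A); ring.
Qed.

Definition qcheby_series : pseries A :=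
  fun n => ((-1) ^+ n * qint q n.+1) *: cheby_at n.

Lemma qcheby_seriesE : qcheby_series =
  (q - q^-1)^-1 *: (q *: cheby_series q - q^-1 *: cheby_series q^-1).
Proof.
apply: pseriesP => n; rewrite pcoefZ pcoefD pcoefN !pcoefZ.
rewrite /pcoef /qcheby_series /cheby_series !scalerA -scalerBl scalerA.
congr (_ *: _); rewrite /qint -exprnN -exprnP [(- q) ^+ n]exprNn [(- q^-1) ^+ n]exprNn.
by rewrite !exprS exprVn invfM; ring.
Qed.

(** The coefficient [[n+1]_q] splits the series into two geometric twists of the
    series of Chebyshev polynomials, which are the inverses of the two quadratic
    factors. *)
Lemma qcheby_seriesP :
  (1 + q^-1 *: (t * ps_const c) + q ^- 2 *: t ^+ 2)
  * (1 + q *: (t * ps_const c) + q ^+ 2 *: t ^+ 2) * qcheby_series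
  = 1 - t ^+ 2.
Proof.
have hp := cheby_seriesP q; have hm := cheby_seriesP q^-1.
rewrite qcheby_seriesE; move: hp hm; rewrite exprVn.
set g := cheby_series q; set g' := cheby_series q^-1; set C := ps_const c.
have tC := @ps_var_central F A.
move=> hp hm.
transitivity ((q - q^-1)^-1 *: (
   q *: ((1 + q^-1 *: (t * C) + q ^- 2 *: t ^+ 2)
      * ((1 + q *: (t * C) + q ^+ 2 *: t ^+ 2) * g))
  - q^-1 *: ((1 + q *: (t * C) + q ^+ 2 *: t ^+ 2)
      * ((1 + q^-1 *: (t * C) + q ^- 2 *: t ^+ 2) * g')))).
  by ncring F (pseries A) [:: C; g; g'] [:: t]; qfield q0 q4.
rewrite hp hm.
by ncring F (pseries A) [:: C] [:: t]; qfield q0 q4.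
Qed.

Lemma qcheby_series_comm (u : A) :
  u * c = c * u -> ps_const u * qcheby_series = qcheby_series * ps_const u.
Proof.
move=> uc; apply: pseriesP => n; rewrite pcoef_constM pcoefM_const.
by rewrite -scalerAr -scalerAl cheby_at_comm.
Qed.

End ChebyshevSeries.

(** * The generating series *)

Section DeltaSeries.
Context (F : fieldType) (q : F) (q0 : q != 0) (q4 : q ^+ 4 != 1).
Context (A : algType F) (c al be ga : A).
Context (alC : central al) (beC : central be) (gaC : central ga).
Context (y : nat -> A).
Context (y_rec : forall n, y n.+2 = lusztig q^-1 (y n.+1) (y n)).
Context (y_aw : aw_triple q (y 0%N) (y 1%N) c al be ga).

Local Notation t := (ps_var A).
Local Notation P := (@ps_const F A).
Local Notation a := (y 0%N).
Local Notation b := (y 1%N).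

Lemma root_aw_triple n : aw_triple q (y n) (y n.+1) c
  (if odd n then be else al) (if odd n then al else be) ga.
Proof.
elim: n => [//|n IH]; rewrite y_rec /= if_neg [if ~~ _ then al else be]if_neg.
by apply: aw_triple_step => //; case: ifP.
Qed.

Definition root_series : pseries A := fun n => y n.+1.
Definition parity_series : pseries A := fun n => if odd n then be else al.
Local Notation x := root_series.
Local Notation e := parity_series.

(** The constant term is chosen such that the coefficient of degree 0 also agrees
    with the closed formula, which gives [- (1 - q ^- 2)] there. *)
Definition delta_series : pseries A :=
  q ^- 2 *: (t * x * P a) - t * P a * x
  + (q ^- 2 - 1) *: (t ^+ 2 * x * x) - (1 - q ^- 2) *: 1.

Let tC : central t. Proof. exact: ps_var_central. Qed.

Let eC : central e.
Proof.
move=> f; apply: pseriesP => n; rewrite !pcoefM (reindex_inj rev_ord_inj) /=.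
apply: eq_bigr => i _; rewrite subSS subKn ?leq_ord //.
by rewrite /pcoef /parity_series; case: ifP => _; [apply: beC | apply: alC].
Qed.

Lemma parity_seriesP : e * (1 - t ^+ 2) = P al + t * P be.
Proof.
rewrite eC; apply: pseriesP => n; rewrite mulrBl mul1r !pcoefD pcoefN.
rewrite pcoef_varXM; case: n => [|[|n]].
- by rewrite pcoef_varM0 subr0 addr0.
- by rewrite pcoef_varMS subr0 add0r.
- rewrite pcoef_varMS subSS subSS subn0 /pcoef /parity_series /= negbK.
  by rewrite subrr addr0.
Qed.

Let root_mul n :
  c * y n.+1 = pcoef e n - q *: y n.+2 - q^-1 *: y n /\
  y n.+1 * c = pcoef e n - q^-1 *: y n.+2 - q *: y n.
Proof.
apply: aw_triple_mul (root_aw_triple n) _ => //.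
by have := root_aw_triple n.+1; rewrite /= !if_neg.
Qed.

Lemma root_seriesL : (1 + q^-1 *: (t * P c) + q ^- 2 *: t ^+ 2) * x =
  P b + q^-1 *: (t * e) - q ^- 2 *: (t * P a).
Proof.
apply: pseriesP => n; rewrite !mulrDl mul1r -!scalerAl -mulrA.
rewrite !pcoefD pcoefN !pcoefZ pcoef_varXM.
case: n => [|n]; first by rewrite !pcoef_varM0 !scaler0 oppr0 !addr0.
rewrite !pcoef_varMS pcoef_constM -[pcoef x n]/(y n.+1) (root_mul n).1.
have -> : (if (1 < n.+1)%N then pcoef x (n.+1 - 2) else 0)
    = y n - pcoef (P a) n :> A.
  by case: n => [|n]; rewrite ?subrr // subSS subSS subn0 subr0.
rewrite -[pcoef x n.+1]/(y n.+2) -[pcoef (P b) n.+1]/(0 : A) add0r.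
by ncring F A [:: y n.+2; y n; pcoef e n; pcoef (P a) n] (@nil A);
  qfield q0 q4.
Qed.

Lemma root_seriesR : x * (1 + q *: (t * P c) + q ^+ 2 *: t ^+ 2) =
  P b + q *: (t * e) - q ^+ 2 *: (t * P a).
Proof.
have -> : x * (1 + q *: (t * P c) + q ^+ 2 *: t ^+ 2) =
    x + q *: (t * (x * P c)) + q ^+ 2 *: (t ^+ 2 * x).
  by ncring F (pseries A) [:: x; P c] [:: t]; qfield q0 q4.
apply: pseriesP => n; rewrite !pcoefD pcoefN !pcoefZ pcoef_varXM.
case: n => [|n]; first by rewrite !pcoef_varM0 !scaler0 oppr0 !addr0.
rewrite !pcoef_varMS pcoefM_const -[pcoef x n]/(y n.+1) (root_mul n).2.
have -> : (if (1 < n.+1)%N then pcoef x (n.+1 - 2) else 0)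
    = y n - pcoef (P a) n :> A.
  by case: n => [|n]; rewrite ?subrr // subSS subSS subn0 subr0.
rewrite -[pcoef x n.+1]/(y n.+2) -[pcoef (P b) n.+1]/(0 : A) add0r.
by ncring F A [:: y n.+2; y n; pcoef e n; pcoef (P a) n] (@nil A);
  qfield q0 q4.
Qed.

Lemma pcoef_delta_series n : pcoef delta_series n.+1 =
  q ^- 2 *: (y n.+1 * a) - a * y n.+1
  + (q ^- 2 - 1) *: \sum_(l < n) y l.+1 * y (n - l)%N.
Proof.
rewrite /delta_series -!mulrA !pcoefD !pcoefN !pcoefZ !pcoef_varMS.
rewrite pcoef_constM pcoefM_const pcoef1 scaler0 subr0.
congr (_ + _ *: _); case: n => [|n]; first by rewrite big_ord0 pcoef_varM0.
rewrite pcoef_varMS pcoefM; apply: eq_bigr => l _.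
by rewrite subSn ?leq_ord.
Qed.

(** The closed formula is a combination of sums of multiples of the Chebyshev
    polynomials [U_(n - 2 l - j)].  Such a sum is the coefficient of the product of
    [qcheby_series] with [t ^+ j] and a series in [t ^+ 2], and this is the total
    cofactor of [qcheby_series]. *)
Definition delta_factor : pseries A := (1 - q ^- 2) *: (
  P (aw_casimir q a b c al be ga) * t ^+ 2 * ps_even A (fun=> 1)
  - P al * P be * t * ps_even A (fun l => l%:R ^+ 2)
  - (P al ^+ 2 + P be ^+ 2) * t ^+ 2 * ps_even A (fun l => 'C(l.+1, 2)%:R)
  - P ga * t - 2 *: (P ga * t ^+ 3 * ps_even A (fun=> 1))
  - 1 - (q ^+ 2 + 1 + q ^- 2) *: t ^+ 2
  - (q + q^-1) ^+ 2 *: (t ^+ 4 * ps_even A (fun=> 1))).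

Lemma delta_factorP : (1 - t ^+ 2) ^+ 3 * delta_factor =
  (1 - q ^- 2) *: ((1 - t ^+ 2) ^+ 2 *
      (P (aw_casimir q a b c al be ga) * t ^+ 2
      - P ga * t * (1 + t ^+ 2)
      - (1 + (q ^+ 2 + 1 + q ^- 2) *: t ^+ 2) * (1 - t ^+ 2)
      - (q + q^-1) ^+ 2 *: t ^+ 4)
    - P al * P be * t ^+ 3 * (1 + t ^+ 2)
    - (P al ^+ 2 + P be ^+ 2) * t ^+ 4).
Proof.
have h1 := ps_even1 A; have h2 := ps_even_sqr A; have h3 := ps_even_bin2 A.
rewrite /delta_factor.
set s1 := ps_even A (fun=> 1) in h1 *.
set s2 := ps_even A (fun l => l%:R ^+ 2) in h2 *.
set s3 := ps_even A _ in h3 *.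
have s1C : central s1 by apply: ps_even_central.
have s2C : central s2 by apply: ps_even_central.
have s3C : central s3 by apply: ps_even_central.
have PalC := ps_const_central alC.
have PbeC := ps_const_central beC.
have PgaC := ps_const_central gaC.
set om := P _.
transitivity ((1 - q ^- 2) *: (
  om * t ^+ 2 * (1 - t ^+ 2) ^+ 2 * ((1 - t ^+ 2) * s1)
  - P al * P be * t * ((1 - t ^+ 2) ^+ 3 * s2)
  - (P al ^+ 2 + P be ^+ 2) * t ^+ 2 * ((1 - t ^+ 2) ^+ 3 * s3)
  - (1 - t ^+ 2) ^+ 3 * (P ga * t)
  - 2 *: (P ga * t ^+ 3 * (1 - t ^+ 2) ^+ 2 * ((1 - t ^+ 2) * s1))
  - (1 - t ^+ 2) ^+ 3 * (1 + (q ^+ 2 + 1 + q ^- 2) *: t ^+ 2)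
  - (q + q^-1) ^+ 2 *: (t ^+ 4 * (1 - t ^+ 2) ^+ 2 * ((1 - t ^+ 2) * s1)))).
  by ncring F (pseries A) [:: om]
    [:: P al; P be; P ga; t; s1; s2; s3]; qfield q0 q4.
rewrite h1 h2 h3.
by ncring F (pseries A) [:: om] [:: P al; P be; P ga; t]; qfield q0 q4.
Qed.

(** Both sides have the same product with [(1 - t ^+ 2) ^+ 2], [L] and [M]; on
    the right this uses that the Casimir element commutes with [c]. *)
Lemma delta_series_factor : delta_series = delta_factor * qcheby_series q c.
Proof.
set w := qcheby_series q c.
set L := 1 + q^-1 *: (t * P c) + q ^- 2 *: t ^+ 2.
set M := 1 + q *: (t * P c) + q ^+ 2 *: t ^+ 2.
have [ra rb rc] := y_aw.
have PalC := ps_const_central alC.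
have PbeC := ps_const_central beC.
have PgaC := ps_const_central gaC.
have P0 (k : F) : pcoef (k *: (t * P c)) 0 = 0.
  by rewrite pcoefZ pcoef_varM0 scaler0.
have t20 : pcoef (t ^+ 2) 0 = 0 by rewrite -[t ^+ 2]mulr1 pcoef_varXM.
have L0 : pcoef L 0 = 1.
  by rewrite !pcoefD P0 pcoefZ t20 pcoef1 scaler0 !addr0.
have M0 : pcoef M 0 = 1.
  by rewrite !pcoefD P0 pcoefZ t20 pcoef1 scaler0 !addr0.
have v0 : pcoef ((1 - t ^+ 2) ^+ 2) 0 = 1.
  rewrite expr2 pcoefM big_ord1 !pcoefD !pcoefN t20 pcoef1 subr0.
  by rewrite mul1r.
apply: (ps_lreg L0); apply: (ps_rreg M0); apply: (ps_lreg v0) => /=.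
have Pdef := (@ps_constD F A, @ps_constN F A, @ps_constZ F A, @ps_constM F A).
have Pom : aw_casimir q (P a) (P b) (P c) (P al) (P be) (P ga) =
    P (aw_casimir q a b c al be ga).
  by rewrite /aw_casimir !expr2 !Pdef.
transitivity ((1 - t ^+ 2) ^+ 3 * delta_factor).
  rewrite delta_factorP -Pom.
  apply: (@aw_generating_identity F q q0 _ _ _ _ _ _ _ PalC PbeC PgaC
    _ _ _ t e) => //.
  - by have := congr1 P ra; rewrite !Pdef.
  - by have := congr1 P rb; rewrite !Pdef.
  - by have := congr1 P rc; rewrite !Pdef.
  - exact: parity_seriesP.
  - exact: root_seriesL.
  - exact: root_seriesR.
have comM (u : pseries A) (z : F) : u * P c = P c * u ->
    u * (1 + z *: (t * P c) + z ^+ 2 *: t ^+ 2) =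
    (1 + z *: (t * P c) + z ^+ 2 *: t ^+ 2) * u.
  move=> uc; transitivity (u + z *: (t * (u * P c)) + z ^+ 2 *: (t ^+ 2 * u)).
    by ncring F (pseries A) [:: u; P c] [:: t]; qfield q0 q4.
  by rewrite uc; ncring F (pseries A) [:: u; P c] [:: t]; qfield q0 q4.
have dc : delta_factor * P c = P c * delta_factor.
  have s1C := @ps_even_central F A (fun=> 1).
  have s2C := @ps_even_central F A (fun l => l%:R ^+ 2).
  have s3C := @ps_even_central F A (fun l => 'C(l.+1, 2)%:R).
  have omc : P (aw_casimir q a b c al be ga) * P c =
      P c * P (aw_casimir q a b c al be ga).
    by rewrite -!ps_constM (aw_casimir_comm q0 alC beC gaC ra rb).
  rewrite /delta_factor.
  set om := P _ in omc *.
  set s1 := ps_even A (fun=> 1) in s1C *.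
  set s2 := ps_even A (fun l => l%:R ^+ 2) in s2C *.
  set s3 := ps_even A _ in s3C *.
  transitivity ((1 - q ^- 2) *: (om * P c * t ^+ 2 * s1
    + P c * (- P al * P be * t * s2 - (P al ^+ 2 + P be ^+ 2) * t ^+ 2 * s3
      - P ga * t - 2 *: (P ga * t ^+ 3 * s1)
      - 1 - (q ^+ 2 + 1 + q ^- 2) *: t ^+ 2
      - (q + q^-1) ^+ 2 *: (t ^+ 4 * s1)))).
    by ncring F (pseries A) [:: om; P c]
      [:: P al; P be; P ga; t; s1; s2; s3]; qfield q0 q4.
  by rewrite omc; ncring F (pseries A) [:: om; P c]
    [:: P al; P be; P ga; t; s1; s2; s3]; qfield q0 q4.
have wc : w * P c = P c * w by rewrite qcheby_series_comm.
have -> : L * (delta_factor * w) * M = delta_factor * (L * M * w).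
  rewrite -!mulrA (comM w q wc) [LHS]mulrA [RHS]mulrA; congr (_ * _).
  by rewrite /L -exprVn; apply/esym/comM.
rewrite qcheby_seriesP //.
by ncring F (pseries A) [:: delta_factor] [:: t]; qfield q0 q4.
Qed.
End DeltaSeries.

(** * Comparison of coefficients *)

Section DeltaCoefficients.
Context (F : fieldType) (q : F) (A : algType F) (c : A).
Local Notation t := (ps_var A).
Local Notation w := (qcheby_series q c).

Lemma pcoef_var_qcheby (j n : nat) : pcoef (t ^+ j * w) n =
  (-1) ^+ (n + j) *: (qint q (n%:Z - j%:Z + 1) *: cheby_at c (n%:Z - j%:Z)).
Proof.
rewrite pcoef_varXM; case: leqP => [jn|nj].
  rewrite subzn // -PoszD addn1 scalerA.
  suff -> : (-1) ^+ (n + j) = (-1) ^+ (n - j) :> F by [].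
  by rewrite -signr_odd oddD -oddB // signr_odd.
have -> : n%:Z - j%:Z = Negz (j - n).-1.
  by rewrite NegzE prednK ?subn_gt0 // -subzn ?opprB // ltnW.
by rewrite /cheby_at /chebyU rmorph0 !scaler0.
Qed.

(** Since [j > 0], every [l] with [2 * l + j <= n] is below [n]; the other terms
    of the sum have a negative index, where [chebyU] vanishes. *)
Lemma pcoef_even_qcheby (k : nat -> F) (j n : nat) : (0 < j)%N ->
  pcoef (t ^+ j * (ps_even A k * w)) n =
  (-1) ^+ (n + j) *: \sum_(l < n) (k l * qint q (n%:Z - 2 * l%:Z - j%:Z + 1))
                       *: cheby_at c (n%:Z - 2 * l%:Z - j%:Z).
Proof.
move=> j0; transitivity
    (\sum_(l < n) k l *: pcoef (t ^+ (l.*2 + j) * w) n : A); last first.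
  rewrite scaler_sumr; apply: eq_bigr => l _.
  rewrite pcoef_var_qcheby PoszD -mul2n PoszM opprD addrA !scalerA.
  rewrite addnA [(n + _ + _)%N]addnAC exprD exprM sqrrN !expr1n mulr1.
  by rewrite [k l * _]mulrC -mulrA.
rewrite pcoef_varXM; case: leqP => [jn|nj].
  rewrite (@pcoef_evenM _ _ _ _ _ n); last first.
    by rewrite -addnn (leq_trans _ (leq_addr _ _)) // ltn_subrL j0 (leq_trans j0).
  apply: eq_bigr => l _; rewrite pcoef_varXM leq_subRL // [(j + _)%N]addnC.
  by rewrite -subnDA [(j + _)%N]addnC; case: ifP; rewrite ?scaler0.
rewrite big1 // => l _; rewrite pcoef_varXM leqNgt.
by rewrite (leq_trans nj) ?leq_addl ?scaler0.
Qed.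

Lemma pcoef_delta_factor (y : nat -> A) (al be ga : A) (n : nat) :
    q != 0 -> q ^+ 4 != 1 -> central al -> central be -> central ga ->
  let U := cheby_at c in
  pcoef (delta_factor q c al be ga y * w) n =
  ((-1) ^+ n * (1 - q ^- 2)) *:
  (aw_casimir q (y 0%N) (y 1%N) c al be ga *
     (\sum_(l < n) qint q (n%:Z - 2 * l%:Z - 1) *: U (n%:Z - 2 * l%:Z - 2))
   + al * be *
     (\sum_(l < n) (l%:R ^+ 2 * qint q (n%:Z - 2 * l%:Z)) *: U (n%:Z - 2 * l%:Z - 1))
   - (al ^+ 2 + be ^+ 2) *
     (\sum_(l < n) ('C(l.+1, 2)%:R * qint q (n%:Z - 2 * l%:Z - 1))
                     *: U (n%:Z - 2 * l%:Z - 2))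
   + ga *
     (qint q n%:Z *: U (n%:Z - 1)
      + 2%:R *: \sum_(l < n) qint q (n%:Z - 2 * l%:Z - 2) *: U (n%:Z - 2 * l%:Z - 3))
   - qint q (n%:Z + 1) *: U n%:Z
   - (qint q 3 * qint q (n%:Z - 1)) *: U (n%:Z - 2)
   - qint q 2 ^+ 2 *:
     \sum_(l < n) qint q (n%:Z - 2 * l%:Z - 3) *: U (n%:Z - 2 * l%:Z - 4)).
Proof.
move=> q0 q4 alC beC gaC U; rewrite qint2 // qint3 //.
have tC := @ps_var_central F A.
have PalC := ps_const_central alC; have PbeC := ps_const_central beC.
have PgaC := ps_const_central gaC.
have s1C := @ps_even_central F A (fun=> 1).
have s2C := @ps_even_central F A (fun l => l%:R ^+ 2).
have s3C := @ps_even_central F A (fun l => 'C(l.+1, 2)%:R).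
set om := aw_casimir _ _ _ _ _ _ _.
have -> : delta_factor q c al be ga y * w = (1 - q ^- 2) *: (
    ps_const om * (t ^+ 2 * (ps_even A (fun=> 1) * w))
    - ps_const (al * be) * (t ^+ 1 * (ps_even A (fun l => l%:R ^+ 2) * w))
    - ps_const (al ^+ 2 + be ^+ 2)
        * (t ^+ 2 * (ps_even A (fun l => 'C(l.+1, 2)%:R) * w))
    - ps_const ga * (t ^+ 1 * w + 2 *: (t ^+ 3 * (ps_even A (fun=> 1) * w)))
    - w - (q ^+ 2 + 1 + q ^- 2) *: (t ^+ 2 * w)
    - (q + q^-1) ^+ 2 *: (t ^+ 4 * (ps_even A (fun=> 1) * w))).
  rewrite /delta_factor -/om; move: om => om.
  rewrite ps_constD !expr2 !ps_constM -!expr2.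
  set s1 := ps_even A (fun=> 1) in s1C *.
  set s2 := ps_even A (fun l => l%:R ^+ 2) in s2C *.
  set s3 := ps_even A _ in s3C *.
  by ncring F (pseries A) [:: ps_const om; w]
    [:: ps_const al; ps_const be; ps_const ga; t; s1; s2; s3]; qfield q0 q4.
rewrite pcoefZ !(pcoefD, pcoefN, pcoefZ, pcoef_constM).
rewrite !pcoef_even_qcheby // !pcoef_var_qcheby.
rewrite -[pcoef w n]/(((-1) ^+ n * qint q n.+1) *: U n) -[n.+1]addn1 PoszD.
(* In the series the quantum integer of each term has index one above that of
   the Chebyshev polynomial. *)
have sub1 (i : int) (j : nat) : i - j.+1%:Z + 1 = i - j%:Z.
  by rewrite -addn1 PoszD opprD addrA subrK.
under [X in om * (_ *: X)]eq_bigr => l _ do rewrite mul1r sub1.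
under [X in al * be * (_ *: X)]eq_bigr => l _ do rewrite sub1 subr0.
under [X in (al ^+ 2 + be ^+ 2) * (_ *: X)]eq_bigr => l _ do rewrite sub1.
under [X in ga * (_ + 2 *: (_ *: X))]eq_bigr => l _ do rewrite mul1r sub1.
under [X in (q + q^-1) ^+ 2 *: (_ *: X)]eq_bigr => l _ do rewrite mul1r sub1.
rewrite !sub1 subr0 !exprD expr1.
set S1 := \sum_(l < n) _; set S2 := \sum_(l < n) _; set S3 := \sum_(l < n) _.
set S4 := \sum_(l < n) _; set S5 := \sum_(l < n) _.
rewrite -/U; move: (U (n%:Z - 1)) (U (n%:Z - 2)) (U n%:Z) => u1 u2 u0.
by ncring F A [:: om; S1; S2; S3; S4; S5; u1; u2; u0] [:: al; be; ga];
  qfield q0 q4.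
Qed.

End DeltaCoefficients.

Lemma delta_series_hom (F : fieldType) (q : F) (A B : algType F)
    (f : {lrmorphism A -> B}) (r : nat -> A) (a : A) (y : nat -> B) (n : nat) :
    y 0%N = f a -> (forall m, y m.+1 = f (r m)) ->
  f (q ^- 2 *: (r n * a) - a * r n
     + (q ^- 2 - 1) *: \sum_(l < n) r l * r (n.+1 - l - 2)%N) =
  pcoef (delta_series q y) n.+1.
Proof.
move=> y0 yS; rewrite pcoef_delta_series y0 yS.
rewrite raddfD raddfB /= !linearZ /= !rmorphM raddf_sum.
congr (_ + _ *: _); apply: eq_bigr => l _; rewrite yS.
have -> : (n - l = (n.+1 - l - 2).+1)%N.
  by rewrite subSn ?(ltnW (ltn_ord l)) // subSS subn1 prednK ?subn_gt0.
by rewrite yS; apply: rmorphM.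
Qed.

Lemma Dq_aw_triple (F : fieldType) (q : F) : q != 0 -> q ^+ 4 != 1 ->
  aw_triple q (DqA : Deltaq q) DqB DqC Dqalpha Dqbeta Dqgamma.
Proof.
move=> q0 q4; have E (x y z : Deltaq q) : q *: (y * z) - q^-1 *: (z * y) =
    (q - q^-1) *: ((q + q^-1) *: aw_elt q x y z) - (q ^+ 2 - q ^- 2) *: x.
  by rewrite /aw_elt; ncring F (Deltaq q) [:: x; y; z] (@nil (Deltaq q));
    qfield q0 q4.
by split; apply: E.
Qed.

Lemma central_scale (F : fieldType) (A : algType F) (k : F) (z : A) :
  central z -> central (k *: z).
Proof. by move=> hz x; rewrite -scalerAl hz scalerAr. Qed.

Lemma Dqalpha_central (F : fieldType) (q : F) : central (Dqalpha : Deltaq q).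
Proof. by apply: central_scale => x; apply: Deltaq_centralA. Qed.

Lemma Dqbeta_central (F : fieldType) (q : F) : central (Dqbeta : Deltaq q).
Proof. by apply: central_scale => x; apply: Deltaq_centralB. Qed.

Lemma Dqgamma_central (F : fieldType) (q : F) : central (Dqgamma : Deltaq q).
Proof. by apply: central_scale => x; apply: Deltaq_centralC. Qed.

Theorem theorem5p6 (F : closedFieldType) (q : F)
    (charF0 : [pchar F] =i pred0)
    (q_neq0 : q != 0)
    (q_nroot : forall m : nat, (0 < m)%N -> q ^+ m != 1)
    (T0 T1 T0i T1i : {lrmorphism Oq q -> Oq q})
    (T0K : cancel T0 T0i) (T0iK : cancel T0i T0)
    (T1K : cancel T1 T1i) (T1iK : cancel T1i T1)
    (T0A : T0 OqA = OqA) (T0B : T0 OqB = lusztig q OqA OqB)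
    (T1B : T1 OqB = OqB) (T1A : T1 OqA = lusztig q OqB OqA)
    (natural : {lrmorphism Oq q -> Deltaq q})
    (naturalA : natural OqA = DqA) (naturalB : natural OqB = DqB)
    (n : nat) (n_gt0 : (0 < n)%N) :
  let U (k : int) : Deltaq q := horner_alg DqC (chebyU F k) in
  natural (Bdelta T0i T1i n) =
  ((-1) ^+ n * (1 - q ^- 2)) *:
  (DqOmega * (\sum_(l < n) qint q (n%:Z - 2 * l%:Z - 1) *: U (n%:Z - 2 * l%:Z - 2))
   + Dqalpha * Dqbeta *
     (\sum_(l < n) (l%:R ^+ 2 * qint q (n%:Z - 2 * l%:Z)) *: U (n%:Z - 2 * l%:Z - 1))
   - (Dqalpha ^+ 2 + Dqbeta ^+ 2) *
     (\sum_(l < n) ('C(l.+1, 2)%:R * qint q (n%:Z - 2 * l%:Z - 1))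
                     *: U (n%:Z - 2 * l%:Z - 2))
   + Dqgamma *
     (qint q n%:Z *: U (n%:Z - 1)
      + 2%:R *: \sum_(l < n) qint q (n%:Z - 2 * l%:Z - 2) *: U (n%:Z - 2 * l%:Z - 3))
   - qint q (n%:Z + 1) *: U n%:Z
   - (qint q 3 * qint q (n%:Z - 1)) *: U (n%:Z - 2)
   - qint q 2 ^+ 2 *:
     \sum_(l < n) qint q (n%:Z - 2 * l%:Z - 3) *: U (n%:Z - 2 * l%:Z - 4)).
Proof.
have q4 : q ^+ 4 != 1 by apply: q_nroot.
have [T0iA T0iB] := cancel_lusztig q_neq0 q4 T0K T0A T0B (Oq_AB q).
have [T1iB T1iA] := cancel_lusztig q_neq0 q4 T1K T1B T1A (Oq_BA q).
pose y m := natural (iter m./2 (T1i \o T0i) (if odd m then OqB else OqA)).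
have yE m : y m.+1 = natural (Broot T0i T1i m) by rewrite /y Broot_iter.
have y_rec m : y m.+2 = lusztig q^-1 (y m.+1) (y m).
  by rewrite /y (iter_lusztig_rec T0iA T0iB T1iB T1iA) lusztig_hom.
have y_aw : aw_triple q (y 0%N) (y 1%N) DqC Dqalpha Dqbeta Dqgamma.
  by rewrite /y /= naturalA naturalB; apply: Dq_aw_triple.
have -> : natural (Bdelta T0i T1i n) = pcoef (delta_series q y) n.
  case: n n_gt0 => // m _.
  have y0 : y 0%N = natural OqA by [].
  have E := @delta_series_hom F q _ _ natural (Broot T0i T1i) OqA y m y0 yE.
  apply: E.
have alC := @Dqalpha_central F q; have beC := @Dqbeta_central F q.
have gaC := @Dqgamma_central F q.
rewrite (delta_series_factor q_neq0 q4 alC beC gaC y_rec y_aw) => U.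
have E := @pcoef_delta_factor F q (Deltaq q) DqC y _ _ _ n q_neq0 q4 alC beC gaC.
have y0 : y 0%N = DqA by exact: naturalA.
have y1 : y 1%N = DqB by exact: naturalB.
have om : aw_casimir q (y 0%N) (y 1%N) DqC Dqalpha Dqbeta Dqgamma = DqOmega.
  by rewrite y0 y1.
rewrite om in E.
exact: E.
Qed.
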